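(* Let $K$ be a finite group and let $\alpha\colon K \to \mathrm{Aut}(A(\mathbb{D}))$ be an action of $K$ on the disk algebra $A(\mathbb{D})$. Then $$\mathrm{ltsr}(\ell^1(K, A(\mathbb{D}), \alpha)) = 2 .$$
   Context: $\mathbb{D}=\{z\in\mathbb{C}: |z|<1\}$, and $A(\mathbb{D})$ is the unital Banach algebra of functions continuous on $\overline{\mathbb{D}}$ and holomorphic on $\mathbb{D}$, with norm $\|f\|=\sup_{z\in\overline{\mathbb{D}}}|f(z)|$. For a unital Banach algebra $A$, $\mathrm{Aut}(A)$ is the group of bounded algebra automorphisms of $A$ with bounded inverse. An action of a discrete group $G$ on $A$ is a map $g\mapsto \alpha^g \in \mathrm{Aut}(A)$ with $\sup_{g}\|\alpha^g\|<\infty$, $\alpha^e=\mathrm{id}$ and $\alpha^{gh}=\alpha^g\alpha^h$. The Banach algebra $\ell^1(G,A,\alpha)$ consists of all $f\colon G\to A$ with $\|f\|=\sum_{g\in G}\|f(g)\|<\infty$, with product $(f_1*f_2)(g)=\sum_{h\in G} f_1(h)\,\alpha^h(f_2(h^{-1}g))$. For a unital ring $A$, $Lg_n(A)$ denotes the set of $n$-tuples of elements of $A$ which generate $A$ as a left ideal. For a unital Banach algebra $A$, the left topological stable rank $\mathrm{ltsr}(A)$ is the least integer $n \ge 1$ such that $Lg_n(A)$ is dense in $A^n$ (and $\infty$ if no such $n$ exists). *)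

(* Defs.v *)
From HB Require Import structures.
From mathcomp Require Import all_boot all_order all_algebra all_fingroup.
From mathcomp Require Import all_classical all_reals all_analysis.
From mathcomp Require Import complex.
Set Implicit Arguments.
Unset Strict Implicit.
Unset Printing Implicit Defensive.
Import Order.TTheory GRing.Theory Num.Theory.
Import numFieldNormedType.Exports.
Local Open Scope classical_set_scope.
Local Open Scope ring_scope.

(* The field of complex numbers.  It is named because the canonical Lmodule
   structure of the bare type R[i] is the one over R, so that R[i] is not
   recognized as a normed module over itself. *)
Definition Cfield (R : realType) : numFieldType := Num.NumField.clone R[i] _.

(* The HB hierarchy has no room for a join of rings and normed modules below
   numDomainType, hence a record.  Multiplication is only required to be
   bounded: for a non-isometric action the l^1 norm is submultiplicative only
   up to a constant.  Completeness is not recorded because no definition below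
   refers to it. *)
Record normedAlg (F : numFieldType) := NormedAlg {
  nalg_alg : algType F;
  nalg_norm : nalg_alg -> F;
  nalg_normD : forall x y, nalg_norm (x + y) <= nalg_norm x + nalg_norm y;
  nalg_normZ : forall (l : F) x, nalg_norm (l *: x) = `|l| * nalg_norm x;
  nalg_norm0_eq0 : forall x, nalg_norm x = 0 -> x = 0;
  nalg_mul_bounded : exists M : F,
    forall x y, nalg_norm (x * y) <= M * (nalg_norm x * nalg_norm y)
}.

Definition nalg_sort (F : numFieldType) (A : normedAlg F) : Type := nalg_alg A.
Coercion nalg_sort : normedAlg >-> Sortclass.

HB.instance Definition _ (F : numFieldType) (A : normedAlg F) :=
  GRing.Algebra.copy (nalg_sort A) (nalg_alg A).
HB.instance Definition _ (F : numFieldType) (A : normedAlg F) :=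
  @Lmodule_isNormed.Build F (nalg_sort A) (@nalg_norm F A)
    (@nalg_normD F A) (@nalg_normZ F A) (@nalg_norm0_eq0 F A).

Section StableRank.
Variable (R : realType) (A : normedAlg (Cfield R)).

Definition Lg (n : nat) : set 'rV[A]_n :=
  [set a | forall x : A, exists b : 'rV[A]_n, x = \sum_(i < n) b 0 i * a 0 i].

Definition ltsr_pred (n : nat) : bool := `[< (1 <= n)%N /\ dense (@Lg n) >].

Definition ltsr : \bar R :=
  if pselect (exists n, ltsr_pred n) is left ex then (ex_minn ex)%:R%:E else +oo%E.

End StableRank.
Arguments Lg {R} A n.
Arguments ltsr_pred {R} A n.

Section Action.
Variables (F : numFieldType) (A : normedAlg F).

Definition bounded_op (f : A -> A) :=
  exists M : F, forall x : A, `|f x| <= M * `|x|.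

Definition banach_aut (f : A -> A) :=
  [/\ linear f, monoid_morphism f, bounded_op f &
      exists g : A -> A, [/\ cancel f g, cancel g f & bounded_op g]].

Record banach_action (G : groupType) := BanachAction {
  act_fun :> G -> A -> A;
  act_aut : forall g, banach_aut (act_fun g);
  act_bounded : exists M : F, forall g x, `|act_fun g x| <= M * `|x|;
  banach_act1 : act_fun 1%g = id;
  banach_actM : forall g h, act_fun (g * h)%g = act_fun g \o act_fun h
}.

End Action.

Section L1.
Variables (F : numFieldType) (K : finGroupType) (A : normedAlg F).

(* K is finite, so every function K -> A is summable. *)
Definition l1_fun (alpha : banach_action A K) : Type := {ffun K -> A}.

Variable alpha : banach_action A K.
Local Notation L := (l1_fun alpha).

HB.instance Definition _ := GRing.Lmodule.copy L {ffun K -> A}.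

Implicit Types f : L.

Definition l1_mul f1 f2 : L :=
  [ffun g => \sum_(h : K) f1 h * alpha h (f2 (h^-1 * g)%g)].

Definition l1_one : L := [ffun g => (g == 1%g)%:R].

Definition l1_norm f : F := \sum_(g : K) `|f g|.

Lemma act_linear g : linear (alpha g).
Proof. by case: (act_aut alpha g). Qed.

HB.instance Definition _ g := GRing.isLinear.Build F A A *:%R (alpha g)
  (act_linear g).

Lemma act_monoid g : monoid_morphism (alpha g).
Proof. by case: (act_aut alpha g). Qed.

HB.instance Definition _ g := GRing.isMonoidMorphism.Build A A (alpha g)
  (act_monoid g).

Lemma l1_mulA : associative l1_mul.
Proof.
move=> f1 f2 f3; apply/ffunP => g; rewrite !ffunE.
under eq_bigr => h _ do rewrite ffunE raddf_sum mulr_sumr.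
under [RHS]eq_bigr => h _ do rewrite ffunE mulr_suml.
rewrite [RHS]exchange_big; apply: eq_bigr => h _ /=.
rewrite [RHS](reindex_inj (mulgI h)); apply: eq_bigr => k _ /=.
by rewrite rmorphM mulrA mulKg invMg mulgA banach_actM.
Qed.

Lemma l1_mul1 : left_id l1_one l1_mul.
Proof.
move=> f; apply/ffunP => g; rewrite ffunE (bigD1 1%g)//= ffunE eqxx mul1r.
rewrite banach_act1 invg1 mul1g big1 ?addr0// => h /negPf h1.
by rewrite ffunE h1 mul0r.
Qed.

Lemma l1_mulr1 : right_id l1_one l1_mul.
Proof.
move=> f; apply/ffunP => g; rewrite ffunE (bigD1 g)//= ffunE mulVg eqxx.
rewrite rmorph1 mulr1 big1 ?addr0// => h hg.
by rewrite ffunE -eq_mulVg1 (negPf hg) raddf0 mulr0.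
Qed.

Lemma l1_mulDl : left_distributive l1_mul +%R.
Proof.
move=> f1 f2 f3; apply/ffunP => g; rewrite !ffunE -big_split/=.
by apply: eq_bigr => h _; rewrite !ffunE mulrDl.
Qed.

Lemma l1_mulDr : right_distributive l1_mul +%R.
Proof.
move=> f1 f2 f3; apply/ffunP => g; rewrite !ffunE -big_split/=.
by apply: eq_bigr => h _; rewrite !ffunE raddfD mulrDr.
Qed.

Lemma l1_one_neq0 : l1_one != 0.
Proof.
by apply/eqP => /ffunP/(_ 1%g)/eqP; rewrite !ffunE eqxx oner_eq0.
Qed.

HB.instance Definition _ := GRing.Zmodule_isNzRing.Build L
  l1_mulA l1_mul1 l1_mulr1 l1_mulDl l1_mulDr l1_one_neq0.

Lemma l1_scalerAl (c : F) f1 f2 : c *: (f1 * f2) = (c *: f1) * f2.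
Proof.
apply/ffunP => g; rewrite !ffunE scaler_sumr; apply: eq_bigr => h _.
by rewrite !ffunE scalerAl.
Qed.

HB.instance Definition _ := GRing.Lmodule_isLalgebra.Build F L l1_scalerAl.

Lemma l1_scalerAr (c : F) f1 f2 : c *: (f1 * f2) = f1 * (c *: f2).
Proof.
apply/ffunP => g; rewrite !ffunE scaler_sumr; apply: eq_bigr => h _.
by rewrite !ffunE linearZ scalerAr.
Qed.

HB.instance Definition _ := GRing.Lalgebra_isAlgebra.Build F L l1_scalerAr.

Lemma l1_normD f1 f2 : l1_norm (f1 + f2) <= l1_norm f1 + l1_norm f2.
Proof.
by rewrite -big_split/=; apply: ler_sum => g _; rewrite ffunE ler_normD.
Qed.

Lemma l1_normZ (c : F) f : l1_norm (c *: f) = `|c| * l1_norm f.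
Proof.
by rewrite mulr_sumr; apply: eq_bigr => g _; rewrite ffunE normrZ.
Qed.

Lemma l1_norm0_eq0 f : l1_norm f = 0 -> f = 0.
Proof.
move=> f0; apply/ffunP => g; rewrite ffunE; apply/eqP; rewrite -normr_eq0.
by apply/eqP; apply: (psumr_eq0P _ f0).
Qed.

Lemma l1_mul_bounded : exists M : F,
  forall f1 f2, l1_norm (f1 * f2) <= M * (l1_norm f1 * l1_norm f2).
Proof.
have [M hM] : exists M : F, forall x y : A, `|x * y| <= M * (`|x| * `|y|).
  exact: (nalg_mul_bounded A).
have [N hN] := act_bounded alpha.
have n1 : 0 < `|1 : A| by rewrite normr_gt0 oner_neq0.
have M0 : 0 <= M.
  rewrite -(pmulr_lge0 _ (mulr_gt0 n1 n1)); apply: le_trans (hM 1 1).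
  exact: normr_ge0.
exists (M * N) => f1 f2.
have sumE (h : K) : \sum_(g : K) `|f2 (h^-1 * g)%g| = l1_norm f2.
  by rewrite /l1_norm [RHS](reindex_inj (mulgI h^-1%g)).
have -> : M * N * (l1_norm f1 * l1_norm f2) =
    \sum_(g : K) \sum_(h : K) M * (`|f1 h| * (N * `|f2 (h^-1 * g)%g|)).
  rewrite exchange_big/= mulr_suml mulr_sumr; apply: eq_bigr => h _.
  by rewrite -mulr_sumr -mulr_sumr -mulr_sumr sumE mulrCA -mulrA mulrCA !mulrA.
apply: ler_sum => g _; rewrite ffunE.
apply: le_trans (ler_norm_sum _ _ _) _; apply: ler_sum => h _.
apply: le_trans (hM _ _) _; rewrite ler_wpM2l// ler_wpM2l//.
Qed.

Definition l1_alg : normedAlg F :=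
  @NormedAlg F L l1_norm l1_normD l1_normZ l1_norm0_eq0 l1_mul_bounded.

End L1.

Section DiskFun.
Variable F : numFieldType.

Definition closed_disk : set F := [set z | `|z| <= 1].

(* 'valL_ 0 f extends f by 0 outside of the closed disk; differentiability at
   a point of the open disk does not depend on the extension. *)
Definition disk_pred : {pred closed_disk -> F^o} := fun f =>
  `[< continuous (f : closed_disk -> F) /\
      forall z : F, `|z| < 1 -> derivable ('valL_ 0 f : F -> F) z 1 >].

Lemma valL_disk (f : closed_disk -> F) (z : closed_disk) :
  'valL_ 0 f (val z) = f z.
Proof. by rewrite -[in RHS](valLK 0 f) /sigL/=. Qed.

Lemma open_disk_near (z : F) : `|z| < 1 -> \forall w \near z, closed_disk w.
Proof.
move=> z1; apply/nbhs_ballP; exists (1 - `|z|); rewrite /= ?subr_gt0// => w.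
rewrite -ball_normE /= => zw; rewrite /closed_disk /=.
rewrite -(subrK z w) (le_trans (ler_normD _ _))// -lerBrDr distrC.
exact: ltW.
Qed.

Lemma derivable_disk (f : closed_disk -> F) (g : F -> F) (z : F) :
  (forall w : closed_disk, g (val w) = f w) ->
  `|z| < 1 -> derivable g z 1 -> derivable ('valL_ 0 f : F -> F) z 1.
Proof.
move=> gf z1; apply: near_eq_derivable.
apply: filterS (open_disk_near z1) => w Dw.
by have := gf (SigSub (mem_set Dw)); rewrite -(valL_disk f).
Qed.

Lemma disk_subring : subring_closed disk_pred.
Proof.
split.
- apply/asboolP; split; first exact: (@cst_continuous closed_disk F 1).
  move=> z z1; apply: (derivable_disk (g := cst 1)) => //; exact: derivable_cst.
- move=> f g /asboolP[cf df] /asboolP[cg dg]; apply/asboolP; split.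
    by move=> x; exact: (@cvgB F F _ (nbhs x) _ f g _ _ (cf x) (cg x)).
  move=> z z1; apply: derivable_disk (derivableB (df _ z1) (dg _ z1)) => // w.
  by rewrite !fctE !valL_disk.
- move=> f g /asboolP[cf df] /asboolP[cg dg]; apply/asboolP; split.
    by move=> x; exact: (@cvgM F _ (nbhs x) _ f g _ _ (cf x) (cg x)).
  move=> z z1; apply: derivable_disk (derivableM (df _ z1) (dg _ z1)) => // w.
  by rewrite !fctE !valL_disk.
Qed.

HB.instance Definition _ := GRing.isSubringClosed.Build (closed_disk -> F^o)
  disk_pred disk_subring.

Lemma disk_scaler : GRing.scaler_closed disk_pred.
Proof.
move=> a f /asboolP[cf df]; apply/asboolP; split.
  by move=> x; exact: (@cvgZl_tmp F F _ (nbhs x) _ a f _ (cf x)).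
move=> z z1; apply: (derivable_disk (g := a \*: ('valL_ 0 f : F -> F))) => //.
  by move=> w; congr (a *: _); exact: valL_disk.
exact: derivableZ (df _ z1).
Qed.

HB.instance Definition _ := GRing.isScaleClosed.Build F (closed_disk -> F^o)
  disk_pred disk_scaler.

Record disk_fun := DiskFun {
  disk_val :> closed_disk -> F^o;
  disk_valP : disk_val \in disk_pred
}.

HB.instance Definition _ := [isSub for disk_val].
HB.instance Definition _ := [Choice of disk_fun by <:].
HB.instance Definition _ :=
  GRing.SubChoice_isSubComPzRing.Build _ _ disk_fun (subringClosedP _).
HB.instance Definition _ := [SubZmodule_isSubLmodule of disk_fun by <:].

Lemma disk0 : closed_disk 0.
Proof. by rewrite /closed_disk/= normr0 ler01. Qed.

Lemma disk_one_neq0 : 1 != 0 :> disk_fun.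
Proof.
apply/eqP => /(congr1 (fun f : disk_fun => f (SigSub (mem_set disk0))))/eqP.
by rewrite [_ == _]oner_eq0.
Qed.

HB.instance Definition _ :=
  GRing.PzSemiRing_isNonZero.Build disk_fun disk_one_neq0.

Lemma disk_scalerAl (a : F) (f g : disk_fun) : a *: (f * g) = (a *: f) * g.
Proof. by apply/val_inj/funext => z; exact: mulrA. Qed.

HB.instance Definition _ :=
  GRing.Lmodule_isLalgebra.Build F disk_fun disk_scalerAl.
HB.instance Definition _ := GRing.Lalgebra_isComAlgebra.Build F disk_fun.

End DiskFun.

Lemma nbhs_dist_continuous (F1 F2 : numFieldType) (h : F1 -> F2) (i : F2 -> F1) :
  (forall e, 0 < e -> 0 < i e) ->
  (forall e z w, 0 < e -> `|z - w| < i e -> `|h z - h w| < e) -> continuous h.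
Proof.
move=> i0 hi z; apply/(@cvgrPdist_lt F2 F2 _ (nbhs z) (nbhs_filter z)) => e e0.
apply/nbhs_ballP; exists (i e) => /=; first exact: i0.
by move=> w; rewrite -ball_normE; exact: hi.
Qed.

Lemma pair_dist_continuous (F1 F2 : numFieldType) (h : F1 * F1 -> F2)
    (i : F2 -> F1) :
  (forall e, 0 < e -> 0 < i e) ->
  (forall e p q, 0 < e -> `|p.1 - q.1| < i e -> `|p.2 - q.2| < i e ->
    `|h p - h q| < e) -> continuous h.
Proof.
move=> i0 hi p; apply/(@cvgrPdist_lt F2 F2 _ (nbhs p) (nbhs_filter p)) => e e0.
apply/nbhs_ballP; exists (i e) => /=; first exact: i0.
by move=> q [] /=; rewrite -!ball_normE; exact: hi.
Qed.

Section DiskAlgebra.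
Variable R : realType.
Local Notation C := (Cfield R).
Local Notation toC x := (x%:C%C : C).
Local Notation D := (@closed_disk C).
Implicit Types f g : disk_fun C.

Definition cabs (z : C) : R := complex.Re `|z|.

(* The norm of a normedModType over C takes its values in C, hence the
   embedding of the real number sup |f|. *)
Definition disk_norm f : C := (sup (range (fun z : D => cabs (f z))))%:C%C.

Lemma cabsE (z : C) : `|z| = toC (cabs z).
Proof. by rewrite RRe_real ?normr_real. Qed.

Lemma lecC (x y : R) : (toC x <= toC y) = (x <= y).
Proof. exact: lecR. Qed.

Lemma ltcC (x y : R) : (toC x < toC y) = (x < y).
Proof. exact: ltcR. Qed.

Lemma cabs_continuous : continuous (cabs : C -> R).
Proof.
apply: (@nbhs_dist_continuous C R _ (fun e => e%:C%C : C)) => [e|e z w _ zw].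
  by rewrite ltcC.
rewrite -ltcC; apply: le_lt_trans zw.
apply: le_trans (ler_dist_dist z w).
have := cabsE (toC (cabs z) - toC (cabs w)).
rewrite (cabsE z) (cabsE w) => ->; rewrite lecC -rmorphB.
by rewrite /cabs normc_def/= expr0n addr0 sqrtr_sqr.
Qed.

Lemma disk_compact : compact (D : set C).
Proof.
pose g (p : R * R) : C := (p.1 +i* p.2)%C.
have gc : continuous g.
  have eE (e : C) : 0 < e -> e = (complex.Re e)%:C%C.
    by move=> e0; rewrite RRe_real// gtr0_real.
  apply: (@pair_dist_continuous R C _ (fun e => complex.Re e / 2)).
    by move=> e e0; rewrite divr_gt0// -ltcC -eE.
  move=> e p q e0 h1 h2.
  have -> : g p - g q = (p.1 - q.1)%:C%C + 'i%C * (p.2 - q.2)%:C%C.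
    by rewrite /g; simpc.
  apply: le_lt_trans (ler_normD _ _) _.
  rewrite normrM !normc_def/= !expr0n/= !addr0 !add0r expr1n sqrtr1 mul1r.
  by rewrite !sqrtr_sqr -rmorphD/= (eE e)// ltcC [ltRHS]splitr ltrD.
apply: (@subclosed_compact _ _ (g @` (`[-1, 1] `*` `[-1, 1]))).
- rewrite (_ : D = cabs @^-1` [set x | x <= 1]); last first.
    by apply/seteqP; split => z; rewrite /closed_disk/= cabsE lecC.
  by apply: closed_comp; [move=> z _; exact: cabs_continuous|exact: closed_le].
- apply: continuous_compact; first exact: continuous_subspaceT.
  by apply: compact_setX; exact: segment_compact.
- move=> z Dz; exists (complex.Re z, complex.Im z); last by case: z {Dz}.
  have h (x y : R) : Num.sqrt (x ^+ 2 + y ^+ 2) <= 1 -> x \in `[-1, 1].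
    move=> xy1; rewrite in_itv/= -ler_norml; apply: le_trans xy1.
    by rewrite -sqrtr_sqr ler_wsqrtr// lerDl sqr_ge0.
  move: Dz; rewrite /closed_disk/= normc_def lecC => Dz.
  by split; [exact: h Dz|apply: h; rewrite addrC; exact: Dz].
Qed.

Lemma disk_has_sup f : has_sup (range (fun z : D => cabs (f z))).
Proof.
have /asboolP[cf _] := disk_valP f.
split; first by exists (cabs (f (SigSub (mem_set (disk0 _))))); eexists.
have [||c _ h] := @compact_EVT_max _ R (cabs \o 'valL_ 0 f) D _ disk_compact.
- by exists 0; exact: disk0.
- apply: within_continuous_comp; first by move=> z _; exact: cabs_continuous.
  exact/subspace_valL_continuousP'.
exists (cabs ('valL_ 0 f c)) => _ [z _ <-].
by have := h (val z) (valP z); rewrite /comp valL_disk.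
Qed.

Lemma cabs_le f (z : D) : `|f z| <= disk_norm f.
Proof.
by rewrite cabsE lecC; apply: sup_upper_bound; [exact: disk_has_sup|exists z].
Qed.

Lemma disk_norm_le f (M : C) : (forall z : D, `|f z| <= M) -> disk_norm f <= M.
Proof.
move=> h; have M0 : 0 <= M := le_trans (normr_ge0 _) (h (SigSub (mem_set (disk0 _)))).
have -> : M = (complex.Re M)%:C%C by rewrite RRe_real// ger0_real.
rewrite lecC; apply: ge_sup; first by case: (disk_has_sup f).
by move=> _ [z _ <-]; rewrite -lecC -cabsE RRe_real ?ger0_real.
Qed.

Lemma disk_normD f g : disk_norm (f + g) <= disk_norm f + disk_norm g.
Proof.
apply: disk_norm_le => z; apply: le_trans (ler_normD _ _) _.
by rewrite lerD// cabs_le.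
Qed.

Lemma disk_norm_ge0 f : 0 <= disk_norm f.
Proof. exact: le_trans (normr_ge0 _) (cabs_le f (SigSub (mem_set (disk0 _)))). Qed.

Lemma disk_normM f g : disk_norm (f * g) <= disk_norm f * disk_norm g.
Proof.
apply: disk_norm_le => z; rewrite [`|_|]normrM.
by rewrite ler_pM// cabs_le.
Qed.

Lemma disk_normZ (c : C) f : disk_norm (c *: f) = `|c| * disk_norm f.
Proof.
have le1 (a : C) h : disk_norm (a *: h) <= `|a| * disk_norm h.
  by apply: disk_norm_le => z; rewrite [`|_|]normrM ler_wpM2l// cabs_le.
apply/eqP; rewrite eq_le le1/=.
have [->|c0] := eqVneq c 0; first by rewrite normr0 mul0r disk_norm_ge0.
rewrite -ler_pdivlMl ?normr_gt0// -normfV.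
by have := le1 c^-1 (c *: f); rewrite scalerA mulVf// scale1r.
Qed.

Lemma disk_norm0_eq0 f : disk_norm f = 0 -> f = 0.
Proof.
move=> f0; apply/val_inj/funext => z; apply/eqP.
by rewrite -normr_le0 -f0 cabs_le.
Qed.

Lemma disk_mul_bounded : exists M : C,
  forall f g, disk_norm (f * g) <= M * (disk_norm f * disk_norm g).
Proof. by exists 1 => f g; rewrite mul1r disk_normM. Qed.

Definition disk_algebra : normedAlg C :=
  @NormedAlg _ (disk_fun C) disk_norm disk_normD disk_normZ disk_norm0_eq0
    disk_mul_bounded.

End DiskAlgebra.

(* Main.v *)
Require Import Defs.
From HB Require Import structures.
From mathcomp Require Import all_boot all_order all_algebra all_fingroup.
From mathcomp Require Import all_classical all_reals all_analysis.
From mathcomp Require Import complex ring lra.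

(** Write A for the disk algebra and L for l^1(K, A), a free left A-module of rank
|K|, and z for the coordinate function.

Single elements do not generate (coord_not_left_invertible).  An automorphism s
of A sends z to a Moebius function (automorphism_moebius), so that |s z| = 1 on
the unit circle.  If b * f = 1 with f close to the element z at the identity of
K, the equation bounds b on the circle, hence on the disk by the maximum
principle; but z vanishes at 0, where the equation then fails.

Pairs generate, up to a small perturbation (generating_pair_dense).  The rational
functions without poles in the closed disk form a dense subring P of A
(rational_dense, by Schur's algorithm), stable under the automorphisms.  Let a
and b have coefficients in P.  Adding a small scalar to a makes the determinant d
of right multiplication by a nonzero.  By Cramer's rule the left ideal of a
contains all multiples of d, and P / d P is finite-dimensional over the complex
numbers (rational_quotient), so that finitely many elements e_k span the
elements with coefficients in P modulo that left ideal.  Modulo the left ideal,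
right multiplication by b acts on the e_k through a complex matrix M, and b + t
generates together with a as soon as M + t is invertible
(generic_left_generation).  The determinant d may vanish on the unit circle: the
argument takes place over P, not over A, and only the equation
x * a + y * b = 1 is carried back to L.

All this rests on the maximum principle for functions that are differentiable in
the complex sense in the open disk and continuous on the closed disk.  Goursat's
argument gives Cauchy's theorem for triangles, in a form where integrals are
replaced by trapezoidal sums with 2^n nodes (goursat); applied to difference
quotients it bounds |f c| by 4 times the maximum of |f| on an annulus around c,
and the factor 4 disappears on taking powers of f (annulus_maximum).  The
maximum principle, first for functions without singularities and then with
exceptional points, follows by a perturbation.  Applied to differences of
difference quotients it shows that singularities at which a function is
continuous are removable (removable_singularity), hence that zeros in the open
disk can be divided out (disk_factor); division gives in turn the equality case
of the maximum principle (strong_maximum), which with the Schwarz lemma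
determines the automorphisms. *)

Set Implicit Arguments.
Unset Strict Implicit.
Unset Printing Implicit Defensive.
Import Order.TTheory GRing.Theory Num.Theory.
Import numFieldNormedType.Exports.
Local Open Scope classical_set_scope.
Local Open Scope ring_scope.

(** * Complex moduli and limits *)

Section Modulus.
Variable R : realType.
Local Notation C := (Cfield R).
Implicit Types z w : C.

Lemma cabs_sqrt z : cabs z = Num.sqrt (complex.Re z ^+ 2 + complex.Im z ^+ 2).
Proof. by rewrite /cabs normc_def. Qed.

Lemma cabs_sq z : cabs z ^+ 2 = complex.Re z ^+ 2 + complex.Im z ^+ 2.
Proof. by rewrite cabs_sqrt sqr_sqrtr// addr_ge0 ?sqr_ge0. Qed.

Lemma cabs_ge0 z : 0 <= cabs z.
Proof. by rewrite cabs_sqrt sqrtr_ge0. Qed.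

Lemma cabs0 : cabs (0 : C) = 0.
Proof. by rewrite /cabs normr0. Qed.

Lemma cabs1 : cabs (1 : C) = 1.
Proof. by rewrite /cabs normr1. Qed.

Lemma cabsN z : cabs (- z) = cabs z.
Proof. by rewrite /cabs normrN. Qed.

Lemma cabsC z w : cabs (z - w) = cabs (w - z).
Proof. by rewrite /cabs distrC. Qed.

Lemma cabsM z w : cabs (z * w) = cabs z * cabs w.
Proof.
apply: (@complexI R); rewrite rmorphM/=.
have := normrM z w; rewrite !cabsE; exact.
Qed.

Lemma cabs_eq0 z : (cabs z == 0) = (z == 0).
Proof.
apply/eqP/eqP => [z0|->]; last exact: cabs0.
by apply/eqP; rewrite -normr_eq0 cabsE z0.
Qed.

Lemma cabs_gt0 z : (0 < cabs z) = (z != 0).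
Proof. by rewrite lt_def cabs_eq0 cabs_ge0 andbT. Qed.

Lemma cabsV z : cabs z^-1 = (cabs z)^-1.
Proof.
have [->|z0] := eqVneq z 0; first by rewrite invr0 cabs0 invr0.
have zn : cabs z != 0 by rewrite cabs_eq0.
by apply: (mulfI zn); rewrite -cabsM !divff// cabs1.
Qed.

Lemma cabsX z n : cabs (z ^+ n) = cabs z ^+ n.
Proof. by elim: n => [|n IH]; rewrite ?expr0 ?cabs1// !exprS cabsM IH. Qed.

Lemma cabsD z w : cabs (z + w) <= cabs z + cabs w.
Proof.
rewrite -lecC rmorphD/=; have := ler_normD z w; rewrite !cabsE; exact.
Qed.

Lemma cabsB z w : cabs (z - w) <= cabs z + cabs w.
Proof. by rewrite -(cabsN w); exact: cabsD. Qed.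

Lemma cabs_tri x z w : cabs (z - w) <= cabs (z - x) + cabs (x - w).
Proof. by have := cabsD (z - x) (x - w); rewrite addrA subrK. Qed.

Lemma cabs_real (x : R) : cabs (x%:C%C : C) = `|x|.
Proof. by rewrite cabs_sqrt/= expr0n addr0 sqrtr_sqr. Qed.

Lemma cabs_nat n : cabs (n%:R : C) = n%:R.
Proof. by rewrite -[RHS]normr_nat -cabs_real rmorph_nat. Qed.

Lemma cabs_half z : cabs (z / 2) = cabs z / 2.
Proof. by rewrite cabsM cabsV cabs_nat. Qed.

Lemma cabs_conj z : cabs (z^*%C : C) = cabs z.
Proof. by rewrite !cabs_sqrt; case: z => a b /=; rewrite sqrrN. Qed.

Lemma mul_conj z : z * (z^*%C : C) = (cabs z ^+ 2)%:C%C.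
Proof.
rewrite cabs_sq; case: z => a b; apply/eqP; rewrite eq_complex/=.
by rewrite mulrN opprK mulrN -!expr2 eqxx/= mulrC addNr.
Qed.

Lemma cReD z w : complex.Re (z + w) = complex.Re z + complex.Re w.
Proof. by case: z w => [? ?] [? ?]. Qed.

Lemma cImD z w : complex.Im (z + w) = complex.Im z + complex.Im w.
Proof. by case: z w => [? ?] [? ?]. Qed.

Lemma cReM z w : complex.Re (z * w) =
  complex.Re z * complex.Re w - complex.Im z * complex.Im w.
Proof. by case: z w => [? ?] [? ?]. Qed.

Lemma cImM z w : complex.Im (z * w) =
  complex.Re z * complex.Im w + complex.Im z * complex.Re w.
Proof. by case: z w => [? ?] [? ?]. Qed.

Lemma cReN z : complex.Re (- z) = - complex.Re z.
Proof. by case: z. Qed.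

Lemma cImN z : complex.Im (- z) = - complex.Im z.
Proof. by case: z. Qed.

Lemma Re_le z : `|complex.Re z| <= cabs z.
Proof. by rewrite cabs_sqrt -[leLHS]sqrtr_sqr ler_wsqrtr// lerDl sqr_ge0. Qed.

Lemma Im_le z : `|complex.Im z| <= cabs z.
Proof. by rewrite cabs_sqrt -[leLHS]sqrtr_sqr ler_wsqrtr// lerDr sqr_ge0. Qed.

Lemma cabs_ReIm z : cabs z <= `|complex.Re z| + `|complex.Im z|.
Proof.
rewrite -(@ler_pXn2r _ 2)// ?nnegrE ?addr_ge0 ?cabs_ge0//.
rewrite cabs_sq -[complex.Re z ^+ 2]real_normK ?num_real//.
rewrite -[complex.Im z ^+ 2]real_normK ?num_real// sqrrD.
by rewrite -addrA lerD2l lerDr mulrn_wge0// mulr_ge0.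
Qed.

Lemma half_half z : z / 2 + z / 2 = z.
Proof. by field. Qed.

End Modulus.

Section Powers.
Variable R : realType.
Implicit Types x y e K : R.

Lemma pow_small x e : 0 <= x -> x < 1 -> 0 < e -> exists N : nat, x ^+ N < e.
Proof.
move=> x0 x1 e0.
have [->|xn0] := eqVneq x 0; first by exists 1%N; rewrite expr1.
have xp : 0 < x by rewrite lt_def xn0.
have bern (y : R) n : 0 <= y -> 1 + n%:R * y <= (1 + y) ^+ n.
  move=> y0; elim: n => [|n IH]; first by rewrite mul0r addr0 expr0.
  rewrite exprS; have := ler_wpM2l (_ : 0 <= 1 + y) IH.
  rewrite -natr1; have : 0 <= n%:R :> R by [].
  by move=> n0 /(_ ltac:(lra)); nra.
pose y := x^-1 - 1.
have y0 : 0 < y by rewrite subr_gt0 invf_gt1.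
exists (Num.bound (e^-1 / y)).
set N := Num.bound _; have NP : e^-1 < N%:R * y.
  by rewrite -ltr_pdivrMr// archi_boundP// divr_ge0// ltW// invr_gt0.
have yE : 1 + y = x^-1 by rewrite /y addrC subrK.
have := bern y N (ltW y0); rewrite yE exprVn => h.
rewrite -[x ^+ N]invrK invf_plt ?posrE ?invr_gt0 ?exprn_gt0//; lra.
Qed.

Lemma halfpow_small K e : 0 < e -> exists N : nat, K / 2 ^+ N < e.
Proof.
move=> e0; have [K0|K0] := leP K 0.
  by exists 0%N; rewrite expr0; lra.
have [| |N hN] := @pow_small 2^-1 (e / K) (ltW _) _ (divr_gt0 e0 K0).
- by lra.
- by lra.
by exists N; rewrite -exprVn mulrC -ltr_pdivlMr.
Qed.

(** A multiplicative constant disappears when an inequality is known for all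
powers. *)
Lemma pow_le x y K : 0 <= x -> 0 <= y -> (forall n, x ^+ n <= K * y ^+ n) ->
  x <= y.
Proof.
move=> x0 y0 h; rewrite leNgt; apply/negP => yx.
have xp : 0 < x by exact: le_lt_trans yx.
have K1 : 1 <= K by have := h 0%N; rewrite !expr0 mulr1.
have [| |N] := @pow_small (y / x) K^-1 (divr_ge0 y0 x0).
- by rewrite ltr_pdivrMr// mul1r.
- by rewrite invr_gt0; lra.
rewrite expr_div_n ltr_pdivrMr ?exprn_gt0// ltr_pdivlMl; last by lra.
by rewrite ltNge h.
Qed.

End Powers.

Section Completeness.
Variable R : realType.
Local Notation C := (Cfield R).

(** Convergence of real functions that oscillate little along a filter; the limit
is constructed as the lower limit. *)
Lemma real_cauchy_lim (T : Type) (F : set_system T) {FF : ProperFilter F}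
    (x : T -> R) :
  (exists e A, F A /\ forall s t, A s -> A t -> `|x s - x t| <= e) ->
  exists l, forall e A, F A -> (forall s t, A s -> A t -> `|x s - x t| <= e) ->
    forall t, A t -> `|l - x t| <= e.
Proof.
move=> [e0 [A0 [FA0 osc0]]].
pose S := [set r | F [set s | r <= x s]].
have ub e A t : F A -> (forall s t, A s -> A t -> `|x s - x t| <= e) -> A t ->
    ubound S (x t + e).
  move=> FA osc At r Sr; have [s [/= rs As]] := filter_ex (filterI Sr FA).
  by have := osc _ _ As At; rewrite ler_norml; lra.
have inS e A t : F A -> (forall s t, A s -> A t -> `|x s - x t| <= e) -> A t ->
    S (x t - e).
  move=> FA osc At; apply: filterS FA => s As /=.
  by have := osc _ _ As At; rewrite ler_norml; lra.
have [t0 At0] := filter_ex FA0.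
have S0 : S !=set0 by exists (x t0 - e0); exact: inS At0.
exists (sup S) => e A FA osc t At; rewrite ler_norml.
have : sup S <= x t + e by apply: ge_sup => //; exact: ub At.
have : x t - e <= sup S.
  apply: ub_le_sup; last exact: inS At.
  by exists (x t0 + e0); exact: ub At0.
lra.
Qed.

Lemma complex_cauchy_lim (T : Type) (F : set_system T) {FF : ProperFilter F}
    (x : T -> C) :
  (exists e A, F A /\ forall s t, A s -> A t -> cabs (x s - x t) <= e) ->
  exists l, forall e A, F A -> (forall s t, A s -> A t -> cabs (x s - x t) <= e) ->
    forall t, A t -> cabs (l - x t) <= 2 * e.
Proof.
move=> [e0 [A0 [FA0 osc0]]].
have re e (A : set T) : (forall s t, A s -> A t -> cabs (x s - x t) <= e) ->
    forall s t, A s -> A t -> `|complex.Re (x s) - complex.Re (x t)| <= e.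
  by move=> h s t As At; apply: le_trans (h _ _ As At); rewrite -cReN -cReD Re_le.
have im e (A : set T) : (forall s t, A s -> A t -> cabs (x s - x t) <= e) ->
    forall s t, A s -> A t -> `|complex.Im (x s) - complex.Im (x t)| <= e.
  by move=> h s t As At; apply: le_trans (h _ _ As At); rewrite -cImN -cImD Im_le.
have [|a ha] := @real_cauchy_lim T F FF (fun t => complex.Re (x t)).
  by exists e0, A0; split=> //; exact: re.
have [|b hb] := @real_cauchy_lim T F FF (fun t => complex.Im (x t)).
  by exists e0, A0; split=> //; exact: im.
exists (a +i* b)%C => e A FA osc t At; apply: le_trans (cabs_ReIm _) _.
rewrite cReD cReN cImD cImN /=.
have := ha _ _ FA (re _ _ osc) _ At; have := hb _ _ FA (im _ _ osc) _ At; lra.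
Qed.

Lemma complex_dyadic_lim (a : nat -> C) K :
  (forall j k, (k <= j)%N -> cabs (a j - a k) <= K / 2 ^+ k) ->
  exists l, forall k, cabs (l - a k) <= 2 * (K / 2 ^+ k).
Proof.
move=> h.
have K0 : 0 <= K.
  by have := h 0%N 0%N (leqnn _); rewrite subrr cabs0 expr0 divr1.
have tail k : \oo [set j : nat | (k <= j)%N] by exists k.
have osc k s t : (k <= s)%N -> (k <= t)%N -> cabs (a s - a t) <= K / 2 ^+ k.
  wlog ts : s t / (t <= s)%N.
    by move=> H ks kt; case/orP: (leq_total t s) => ?;
      [exact: H|rewrite cabsC; exact: H].
  move=> _ kt; apply: le_trans (h _ _ ts) _; rewrite ler_wpM2l// lef_pV2.
  - by rewrite ler_weXn2l// ler1n.
  - by rewrite posrE exprn_gt0.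
  - by rewrite posrE exprn_gt0.
have [|l hl] := @complex_cauchy_lim nat \oo _ a.
  by exists (K / 2 ^+ 0), [set j | (0 <= j)%N]; split => //; exact: osc.
by exists l => k; apply: (hl _ _ (tail k)); [exact: osc|exact: leqnn].
Qed.

End Completeness.

(** * Goursat's theorem for trapezoidal sums *)

Section Derivable.
Variable R : realType.
Local Notation C := (Cfield R).

Implicit Types (f g : C -> C) (z k : C).

(** Rules of differentiation in eta-expanded form, so that they apply by
pattern unification to explicit expressions in the variable. *)
Lemma derivable_pid z : derivable (fun w : C => w) z 1.
Proof. exact: derivable_id. Qed.

Lemma derivable_pcst k z : derivable (fun _ : C => k) z 1.
Proof. exact: derivable_cst. Qed.

Lemma derivable_padd f g z : derivable f z 1 -> derivable g z 1 ->
  derivable (fun w => f w + g w) z 1.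
Proof. exact: derivableD. Qed.

Lemma derivable_psub f g z : derivable f z 1 -> derivable g z 1 ->
  derivable (fun w => f w - g w) z 1.
Proof. exact: derivableB. Qed.

Lemma derivable_pmul f g z : derivable f z 1 -> derivable g z 1 ->
  derivable (fun w => f w * g w) z 1.
Proof. exact: derivableM. Qed.

Lemma derivable_pinv f z : f z != 0 -> derivable f z 1 ->
  derivable (fun w => (f w)^-1) z 1.
Proof. exact: derivableV. Qed.

Lemma derivable_pexp f n z : derivable f z 1 -> derivable (fun w => f w ^+ n) z 1.
Proof.
move=> df; elim: n => [|n IH]; first exact: derivable_pcst.
have -> : (fun w => f w ^+ n.+1) = (fun w => f w * f w ^+ n).
  by apply/funext => w; rewrite exprS.
exact: derivable_pmul.
Qed.

Lemma derivable_near f g z : (\forall w \near z, f w = g w) ->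
  derivable f z 1 -> derivable g z 1.
Proof. exact: near_eq_derivable. Qed.

Lemma derivable_approx f z : derivable f z 1 ->
  forall e : R, 0 < e -> exists2 d : R, 0 < d & forall w : C,
    cabs (w - z) < d ->
    cabs (f w - f z - 'D_1 f z * (w - z)) <= e * cabs (w - z).
Proof.
rewrite /derivable => df; set l := 'D_1 f z.
have := iffLR (@cvgrPdist_lt C C _ (dnbhs 0) (dnbhs_filter 0) _ l) df.
move=> hl e e0.
have /hl : (0 : C) < e%:C%C by rewrite ltcC.
move=> /nbhs_ballP[d /= d0 hd].
have dE : d = (complex.Re d)%:C%C by rewrite RRe_real// gtr0_real.
exists (complex.Re d); first by rewrite -ltcC -dE.
move=> w wz; have [->|wzn] := eqVneq w z.
  by rewrite !subrr mulr0 subr0 cabs0 mulr0.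
have wz0 : w - z != 0 by rewrite subr_eq0.
have := hd (w - z); rewrite -ball_normE /= sub0r normrN cabsE dE ltcC wz.
move=> /(_ isT wz0); rewrite /shift /= /GRing.scale /= mulr1 subrK cabsE ltcC.
move=> hlt; rewrite -[f w - f z](mulVKf wz0) mulrC -mulrBl cabsM (cabsC _ l).
by rewrite ler_wpM2r ?cabs_ge0// ltW.
Qed.

Lemma approx_derivable f z (l : C) :
  (forall e : R, 0 < e -> exists2 d : R, 0 < d & forall w : C,
    cabs (w - z) < d -> cabs (f w - f z - l * (w - z)) <= e * cabs (w - z)) ->
  derivable f z 1.
Proof.
move=> h; apply/cvg_ex; exists l.
apply: (iffRL (@cvgrPdist_lt C C _ (dnbhs 0) (dnbhs_filter 0) _ l)) => e e0.
have eE : e = (complex.Re e)%:C%C by rewrite RRe_real// gtr0_real.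
have e1 : 0 < complex.Re e by rewrite -ltcC -eE.
have [|d d0 hd] := h (complex.Re e / 2); first by rewrite divr_gt0.
apply/nbhs_ballP; exists (d%:C%C : C); first by rewrite /= ltcC.
move=> y; rewrite -ball_normE /= sub0r normrN cabsE ltcC => yd y0.
rewrite /shift /= /GRing.scale /= mulr1.
have := hd (y + z); rewrite addrK => /(_ yd) hy.
have -> : l - y^-1 * (f (y + z) - f z) = - (y^-1 * (f (y + z) - f z - l * y)).
  by field.
rewrite normrN cabsE eE ltcC cabsM cabsV ltr_pdivrMl ?cabs_gt0//.
apply: le_lt_trans hy _; rewrite mulrC ltr_pM2l ?cabs_gt0//.
by rewrite ltr_pdivrMr// ltr_pMr// ltr1n.
Qed.

End Derivable.

Section Contour.
Variable R : realType.
Local Notation C := (Cfield R).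
Implicit Types (f g : C -> C) (S : set C) (a b c : C).

(** The trapezoidal sum of f along the segment from a to b cut into 2 ^ n equal
pieces.  It stands in for a contour integral: all the additivity used below
holds exactly at a fixed n, so that no integral of a complex function is
needed. *)
Fixpoint seg_sum f n a b : C :=
  if n is m.+1 then seg_sum f m a ((a + b) / 2) + seg_sum f m ((a + b) / 2) b
  else (b - a) * ((f a + f b) / 2).

Definition midpoint_closed S := forall x y, S x -> S y -> S ((x + y) / 2).

(** Closedness, in terms of the real-valued modulus. *)
Definition limit_closed S :=
  forall z, (forall e : R, 0 < e -> exists2 w, S w & cabs (w - z) < e) -> S z.

Lemma seg_sumC f n a b : seg_sum f n b a = - seg_sum f n a b.
Proof.
elim: n a b => [|n IH] a b /=; first by field.
rewrite [b + a]addrC (IH a ((a + b) / 2)) (IH ((a + b) / 2) b); ring.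
Qed.

Lemma seg_sum_comb f g k n a b :
  seg_sum (fun z => f z + k * g z) n a b = seg_sum f n a b + k * seg_sum g n a b.
Proof.
elim: n a b => [|n IH] a b /=; first by field.
by rewrite !IH mulrDr addrACA.
Qed.

Lemma seg_sum_affine (l k : C) n a b :
  seg_sum (fun z => l * z + k) n a b = (b - a) * (l * ((a + b) / 2) + k).
Proof. by elim: n a b => [|n IH] a b /=; rewrite ?IH; field. Qed.

Lemma seg_sum_eq S f g n a b : midpoint_closed S -> S a -> S b ->
  (forall z, S z -> f z = g z) -> seg_sum f n a b = seg_sum g n a b.
Proof.
move=> mS + + fg; elim: n a b => [|n IH] a b Sa Sb /=; first by rewrite !fg.
by rewrite !IH//; exact: mS.
Qed.

Lemma seg_sum_bound S f m n a b : midpoint_closed S -> S a -> S b ->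
  (forall z, S z -> cabs (f z) <= m) -> cabs (seg_sum f n a b) <= m * cabs (b - a).
Proof.
move=> mS + + fm; elim: n a b => [|n IH] a b Sa Sb /=.
  rewrite cabsM mulrC ler_wpM2r ?cabs_ge0// cabs_half ler_pdivrMr//.
  by apply: le_trans (cabsD _ _) _; have := fm _ Sa; have := fm _ Sb; lra.
apply: le_trans (cabsD _ _) _.
have h1 := IH _ _ Sa (mS _ _ Sa Sb); have h2 := IH _ _ (mS _ _ Sa Sb) Sb.
apply: le_trans (lerD h1 h2) _.
have -> : (a + b) / 2 - a = (b - a) / 2 by field.
have -> : b - (a + b) / 2 = (b - a) / 2 by field.
by rewrite cabs_half; lra.
Qed.

Definition tri_sum f n a b c := seg_sum f n a b + seg_sum f n b c + seg_sum f n c a.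

Definition perimeter a b c : R := cabs (b - a) + cabs (c - b) + cabs (a - c).

Lemma tri_sum_split f n a b c :
  tri_sum f n.+1 a b c =
    tri_sum f n a ((a + b) / 2) ((a + c) / 2) +
    tri_sum f n b ((b + c) / 2) ((a + b) / 2) +
    tri_sum f n c ((a + c) / 2) ((b + c) / 2) +
    tri_sum f n ((b + c) / 2) ((a + c) / 2) ((a + b) / 2).
Proof.
rewrite /tri_sum /= [c + a]addrC.
rewrite (seg_sumC f n ((a + c) / 2) ((a + b) / 2)).
rewrite (seg_sumC f n ((b + c) / 2) ((a + b) / 2)).
rewrite (seg_sumC f n ((b + c) / 2) ((a + c) / 2)).
ring.
Qed.

Lemma tri_sum_affine (l k : C) n a b c : tri_sum (fun z => l * z + k) n a b c = 0.
Proof. by rewrite /tri_sum !seg_sum_affine; field. Qed.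

Lemma tri_sum_bound S f m n a b c : midpoint_closed S -> S a -> S b -> S c ->
  (forall z, S z -> cabs (f z) <= m) ->
  cabs (tri_sum f n a b c) <= m * perimeter a b c.
Proof.
move=> mS Sa Sb Sc fm; rewrite /tri_sum /perimeter !mulrDr.
have := cabsD (seg_sum f n a b + seg_sum f n b c) (seg_sum f n c a).
have := cabsD (seg_sum f n a b) (seg_sum f n b c).
have := seg_sum_bound n mS Sa Sb fm; have := seg_sum_bound n mS Sb Sc fm.
have := seg_sum_bound n mS Sc Sa fm; lra.
Qed.

Lemma perimeter_ge0 a b c : 0 <= perimeter a b c.
Proof. by rewrite !addr_ge0 ?cabs_ge0. Qed.

Lemma disc_midpoint_closed (z : C) (r : R) :
  midpoint_closed [set w | cabs (w - z) <= r].
Proof.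
move=> x y /= hx hy.
have -> : (x + y) / 2 - z = ((x - z) + (y - z)) / 2 by field.
by rewrite cabs_half; have := cabsD (x - z) (y - z); lra.
Qed.

(* The order of the vertices gives every medial triangle the orientation of abc,
as the decomposition of the sums requires. *)
Let medial a b c (t : C * C * C) :=
  [\/ t = (a, (a + b) / 2, (a + c) / 2), t = (b, (b + c) / 2, (a + b) / 2),
      t = (c, (a + c) / 2, (b + c) / 2) |
      t = ((b + c) / 2, (a + c) / 2, (a + b) / 2)].

Let per (t : C * C * C) := perimeter t.1.1 t.1.2 t.2.

Let medial_per a b c t : medial a b c t -> per t = perimeter a b c / 2.
Proof.
have e1 (x y z : C) : (x + y) / 2 - (x + z) / 2 = (y - z) / 2 by field.
have e2 (x y z : C) : (x + y) / 2 - (z + x) / 2 = (y - z) / 2 by field.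
have e3 (x y z : C) : (y + x) / 2 - (z + x) / 2 = (y - z) / 2 by field.
have e4 (x y z : C) : (y + x) / 2 - (x + z) / 2 = (y - z) / 2 by field.
have e5 (x y : C) : (x + y) / 2 - x = (y - x) / 2 by field.
have e6 (x y : C) : x - (x + y) / 2 = (x - y) / 2 by field.
have e7 (x y : C) : (x + y) / 2 - y = (x - y) / 2 by field.
have e8 (x y : C) : y - (x + y) / 2 = (y - x) / 2 by field.
rewrite /per /perimeter; move=> [] -> /=;
  rewrite ?(e5, e6, e7, e8) ?(e1, e2, e3, e4) !cabs_half;
  rewrite ?[cabs (a - b)]cabsC ?[cabs (b - c)]cabsC ?[cabs (c - a)]cabsC; lra.
Qed.

Let medial_shift a b c t : medial a b c t ->
  cabs (t.1.1 - a) <= perimeter a b c.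
Proof.
rewrite /perimeter; have := cabs_ge0 (b - a); have := cabs_ge0 (c - b).
have := cabs_ge0 (a - c); have := cabsC a c; move=> ? ? ? ? [] -> /=.
- by rewrite subrr cabs0; lra.
- by lra.
- by lra.
- have -> : (b + c) / 2 - a = ((b - a) + (c - a)) / 2 by field.
  by rewrite cabs_half; have := cabsD (b - a) (c - a); lra.
Qed.

(** Goursat's argument: if the sums around abc were not small compared with the
square of the perimeter, the same would hold for one of the four medial
triangles, hence for a sequence of triangles that shrink to a point of S; but
near that point f is affine up to an error that makes the sums small, and the
sums of an affine function around a triangle vanish. *)
Lemma goursat_scaled S f a b c (e : R) : midpoint_closed S -> limit_closed S ->
  (forall z, S z -> derivable f z 1) -> S a -> S b -> S c -> 0 < e ->
  exists N, forall n, (N <= n)%N ->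
    cabs (tri_sum f n a b c) <= e * perimeter a b c ^+ 2.
Proof.
move=> mS lS df Sa Sb Sc e0.
pose good (t : C * C * C) := exists N, forall n, (N <= n)%N ->
  cabs (tri_sum f n t.1.1 t.1.2 t.2) <= e * per t ^+ 2.
pose bad (t : C * C * C) := [/\ S t.1.1, S t.1.2, S t.2 & ~ good t].
have step t : bad t -> exists t', bad t' /\ medial t.1.1 t.1.2 t.2 t'.
  case: t => [[x y] z] [/= Sx Sy Sz ngood]; apply: contrapT => /forallNP nex.
  have ok t' : medial x y z t' -> S t'.1.1 -> S t'.1.2 -> S t'.2 -> good t'.
    by move=> mt' S1 S2 S3; apply: contrapT => ng; apply: (nex t').
  apply: ngood.
  have [N1 h1] : good (x, (x + y) / 2, (x + z) / 2).
    by apply: ok => //; [exact: Or41|exact: mS|exact: mS].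
  have [N2 h2] : good (y, (y + z) / 2, (x + y) / 2).
    by apply: ok => //; [exact: Or42|exact: mS|exact: mS].
  have [N3 h3] : good (z, (x + z) / 2, (y + z) / 2).
    by apply: ok => //; [exact: Or43|exact: mS|exact: mS].
  have [N4 h4] : good ((y + z) / 2, (x + z) / 2, (x + y) / 2).
    by apply: ok => //; [exact: Or44|exact: mS|exact: mS|exact: mS].
  exists (maxn (maxn N1 N2) (maxn N3 N4)).+1 => -[//|n].
  rewrite ltnS !geq_max => /andP[/andP[n1 n2] /andP[n3 n4]] /=.
  rewrite tri_sum_split /per/=.
  move: (h1 _ n1) (h2 _ n2) (h3 _ n3) (h4 _ n4) => /=.
  rewrite (@medial_per x y z _ (Or41 _ _ _ erefl)).
  rewrite (@medial_per x y z _ (Or42 _ _ _ erefl)).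
  rewrite (@medial_per x y z _ (Or43 _ _ _ erefl)).
  rewrite (@medial_per x y z _ (Or44 _ _ _ erefl)).
  rewrite !expr_div_n.
  set A := tri_sum _ _ _ _ _; set B := tri_sum _ _ _ _ _.
  set D := tri_sum _ _ _ _ _; set E := tri_sum _ _ _ _ _.
  have := cabsD (A + B + D) E; have := cabsD (A + B) D; have := cabsD A B.
  set p := perimeter x y z ^+ 2; have -> : e * (p / 2 ^+ 2) = e * p / 4.
    by field.
  lra.
apply: contrapT => ngood.
pose T := {t | bad t}.
pose t0 : T := exist _ (a, b, c) (And4 Sa Sb Sc ngood).
pose nxt (t : T) : T := let: exist t1 bt := cid (step (sval t) (svalP t)) in
  exist _ t1 (proj1 bt).
have nxtP t : medial (sval t).1.1 (sval t).1.2 (sval t).2 (sval (nxt t)).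
  by rewrite /nxt; case: cid => t1 [].
pose u k := sval (iter k nxt t0).
pose p := perimeter a b c.
have uper k : per (u k) = p / 2 ^+ k.
  elim: k => [|k IH]; first by rewrite expr0 divr1.
  rewrite (medial_per (nxtP (iter k nxt t0))) -/(per (u k)) IH exprS; field.
  by rewrite expf_neq0.
have ustep k : cabs ((u k.+1).1.1 - (u k).1.1) <= p / 2 ^+ k.
  by rewrite -uper; exact: medial_shift (nxtP (iter k nxt t0)).
have p0 : 0 <= p := perimeter_ge0 a b c.
have udist k j : cabs ((u (k + j)%N).1.1 - (u k).1.1) <=
    2 * p / 2 ^+ k - 2 * p / 2 ^+ (k + j).
  elim: j => [|j IH]; first by rewrite addn0 !subrr cabs0.
  rewrite addnS; apply: le_trans (cabs_tri (u (k + j)%N).1.1 _ _) _.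
  apply: le_trans (lerD (ustep _) IH) _.
  have -> : p / 2 ^+ (k + j) = 2 * p / 2 ^+ (k + j).+1.
    by rewrite exprS; field; rewrite expf_neq0.
  have -> : 2 * p / 2 ^+ (k + j) = 2 * (2 * p / 2 ^+ (k + j).+1).
    by rewrite exprS; field; rewrite expf_neq0.
  lra.
have [|z0 hz0] := @complex_dyadic_lim R (fun k => (u k).1.1) (2 * p).
  move=> j k kj; rewrite -(subnKC kj); apply: le_trans (udist _ _) _.
  by rewrite gerBl divr_ge0 ?exprn_ge0// mulr_ge0.
have Su k : [/\ S (u k).1.1, S (u k).1.2, S (u k).2 & ~ good (u k)].
  exact: (svalP (iter k nxt t0)).
have Sz0 : S z0.
  apply: lS => d d0; have [N hN] := halfpow_small (4 * p) d0.
  exists (u N).1.1; first by case: (Su N).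
  rewrite cabsC; apply: le_lt_trans (hz0 N) _.
  by rewrite mulrA; have -> : 2 * (2 * p) = 4 * p by ring.
pose l := 'D_1 f z0; have hl := derivable_approx (df z0 Sz0).
have [|d d0 hd] := hl (e / 5); first by lra.
have [N hN] := halfpow_small (5 * p) d0.
have [S1 S2 S3] := Su N; apply; exists 0%N => n _.
(* r is f minus its affine approximation at z0. *)
pose r (z : C) := f z + (-1) * (l * z + (f z0 - l * z0)).
have -> : tri_sum f n (u N).1.1 (u N).1.2 (u N).2 =
          tri_sum r n (u N).1.1 (u N).1.2 (u N).2.
  rewrite /tri_sum /r !(seg_sum_comb f (fun z => l * z + _)).
  have := tri_sum_affine l (f z0 - l * z0) n (u N).1.1 (u N).1.2 (u N).2.
  rewrite /tri_sum; set A := seg_sum (fun z => _) _ _ _.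
  set B := seg_sum (fun z => _) _ _ _; set D := seg_sum (fun z => _) _ _ _.
  move=> ABD; rewrite -[LHS]addr0 -oppr0 -ABD; ring.
have hN' : per (u N) * 5 < d by rewrite uper mulrC mulrA.
have z1 : cabs ((u N).1.1 - z0) <= 4 * per (u N).
  by rewrite cabsC uper; have := hz0 N; lra.
have bnd (z : C) : cabs (z - z0) <= 5 * per (u N) -> cabs (r z) <= e * per (u N).
  move=> hz; have -> : r z = f z - f z0 - l * (z - z0) by rewrite /r; ring.
  have /hd : cabs (z - z0) < d by lra.
  by move=> h; apply: le_trans h _; have := cabs_ge0 (z - z0); nra.
have := @tri_sum_bound [set w | cabs (w - z0) <= 5 * per (u N)] r
  (e * per (u N)) n (u N).1.1 (u N).1.2 (u N).2 (@disc_midpoint_closed _ _).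
have pd : cabs ((u N).1.2 - (u N).1.1) + cabs ((u N).2 - (u N).1.2) +
   cabs ((u N).1.1 - (u N).2) = per (u N) by [].
have := cabs_ge0 ((u N).1.2 - (u N).1.1); have := cabs_ge0 ((u N).2 - (u N).1.2).
have := cabs_ge0 ((u N).1.1 - (u N).2).
have := cabs_tri (u N).1.1 (u N).1.2 z0; have := cabs_tri (u N).1.1 (u N).2 z0.
have := cabsC (u N).2 (u N).1.1.
move=> ? ? ? ? ? ? /= h; rewrite expr2 mulrA; apply: h; [lra|lra|lra|exact: bnd].
Qed.

Lemma goursat S f a b c (e : R) : midpoint_closed S -> limit_closed S ->
  (forall z, S z -> derivable f z 1) -> S a -> S b -> S c -> 0 < e ->
  exists N, forall n, (N <= n)%N -> cabs (tri_sum f n a b c) <= e.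
Proof.
move=> mS lS df Sa Sb Sc e0; set p := perimeter a b c.
have p1 : 0 < p ^+ 2 + 1 by rewrite ltr_wpDl ?sqr_ge0.
have [N hN] := goursat_scaled mS lS df Sa Sb Sc (divr_gt0 e0 p1).
exists N => n /hN h; apply: le_trans h _; rewrite -/p mulrAC ler_pdivrMr//.
by rewrite ler_wpM2l ?ltW// ltrDl.
Qed.

End Contour.

(** * Cauchy estimates on an annulus *)

Section LocalMaximum.
Variable R : realType.
Local Notation C := (Cfield R).
Implicit Types (f g : C -> C) (S : set C) (a b c u v z : C) (s h e m d : R).

Lemma disc_limit_closed z0 s : limit_closed [set z : C | cabs (z - z0) <= s].
Proof.
move=> z hz /=; apply/ler_addgt0Pr => e /hz[w /= ws wz].
by have := cabs_tri w z z0; rewrite (cabsC z w); lra.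
Qed.

Lemma halfplane_limit_closed u z0 h :
  limit_closed [set z : C | h <= complex.Re (u * (z - z0))].
Proof.
move=> z hz /=; apply/ler_addgt0Pr => e e0.
have u1 : 0 < cabs u + 1 by rewrite ltr_wpDl ?cabs_ge0.
have [w /= wh wz] := hz _ (divr_gt0 e0 u1).
have -> : u * (z - z0) = u * (w - z0) + u * (z - w) by ring.
rewrite cReD; have := Re_le (u * (z - w)); rewrite cabsM (cabsC z w).
move: wz; rewrite ltr_pdivlMr// ler_norml; have := cabs_ge0 (w - z).
have := cabs_ge0 u; nra.
Qed.

Lemma halfplane_midpoint_closed u z0 h :
  midpoint_closed [set z : C | h <= complex.Re (u * (z - z0))].
Proof.
move=> x y /= hx hy.
have e : u * ((x + y) / 2 - z0) + u * ((x + y) / 2 - z0) =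
         u * (x - z0) + u * (y - z0) by field.
by have := congr1 (@complex.Re R) e; rewrite !cReD; lra.
Qed.

Lemma setI_midpoint_closed S T : midpoint_closed S -> midpoint_closed T ->
  midpoint_closed (S `&` T).
Proof. by move=> mS mT x y [Sx Tx] [Sy Ty]; split; [exact: mS|exact: mT]. Qed.

Lemma setI_limit_closed S T : limit_closed S -> limit_closed T ->
  limit_closed (S `&` T).
Proof.
move=> lS lT z hz; split; [apply: lS|apply: lT] => e /hz[w [Sw Tw] wz];
  by exists w.
Qed.

(** A singularity at a vertex is harmless for a bounded function: cutting off
smaller and smaller corners leaves triangles to which Goursat's theorem applies,
and the sum around the corner is at most a bound times its perimeter. *)
Lemma goursat_corner g u z0 s h M d (k : nat) : 0 < h -> 0 < d -> 0 <= M ->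
  (forall z, cabs (z - z0) <= s -> z != z0 -> derivable g z 1) ->
  (forall z, cabs (z - z0) <= d -> cabs (g z) <= M) ->
  forall b c e, 0 < e -> cabs (b - z0) <= s -> cabs (c - z0) <= s ->
  cabs (b - z0) <= 2 ^+ k * d -> cabs (c - z0) <= 2 ^+ k * d ->
  h <= 2 ^+ k * complex.Re (u * (b - z0)) ->
  h <= 2 ^+ k * complex.Re (u * (c - z0)) ->
  exists N, forall n, (N <= n)%N ->
    cabs (tri_sum g n z0 b c) <= e + M * (perimeter z0 b c / 2 ^+ k).
Proof.
move=> h0 d0 M0 dg gM; elim: k h h0 => [|k IH] h h0 b c e e0 bs cs.
  rewrite !expr0 !mul1r divr1 => bd cd _ _; exists 0%N => n _.
  apply: ler_wpDl; first exact: ltW.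
  apply: (tri_sum_bound n (@disc_midpoint_closed _ z0 d)) => //=.
  by rewrite subrr cabs0 ltW.
move=> bd cd bh ch.
have hm (x y : C) : (x + y) / 2 - x = (y - x) / 2 by field.
have Rehm (x : C) : complex.Re (u * ((z0 + x) / 2 - z0)) =
    complex.Re (u * (x - z0)) / 2.
  rewrite hm mulrA; have e1 := half_half (u * (x - z0)).
  by have := congr1 (@complex.Re R) e1; rewrite cReD; lra.
have half (x : C) : cabs ((z0 + x) / 2 - z0) = cabs (x - z0) / 2.
  by rewrite hm cabs_half.
have p2 : 0 < 2 ^+ k :> R by rewrite exprn_gt0.
move: bd cd bh ch; rewrite exprS => bd cd bh ch.
have [||||||||N0 h0N] := IH (h / 4) (divr_gt0 h0 _) ((z0 + b) / 2) ((z0 + c) / 2) (e / 4);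
  rewrite ?half ?Rehm.
- by [].
- by rewrite divr_gt0.
- by have := cabs_ge0 (b - z0); lra.
- by have := cabs_ge0 (c - z0); lra.
- by lra.
- by lra.
- by rewrite mulrA; lra.
- by rewrite mulrA; lra.
pose t := h / 2 ^+ k / 4.
have t0 : 0 < t by rewrite !divr_gt0.
pose S := [set z : C | cabs (z - z0) <= s] `&`
          [set z : C | t <= complex.Re (u * (z - z0))].
have mS : midpoint_closed S.
  apply: setI_midpoint_closed; first exact: disc_midpoint_closed.
  exact: halfplane_midpoint_closed.
have lS : limit_closed S.
  apply: setI_limit_closed; first exact: disc_limit_closed.
  exact: halfplane_limit_closed.
have dS z : S z -> derivable g z 1.
  move=> [/= z1 z2]; apply: dg => //; apply: contraTneq z2 => ->.
  by rewrite subrr mulr0 -ltNge.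
have th (x : C) : h <= 2 * 2 ^+ k * complex.Re (u * (x - z0)) ->
    t <= complex.Re (u * (x - z0)) / 2.
  by rewrite /t ler_pdivrMr// ler_pdivrMr//; lra.
have hb := th _ bh; have hc := th _ ch.
have Sb : S b by split => //=; lra.
have Sc : S c by split => //=; lra.
have Sb' : S ((z0 + b) / 2).
  by split; rewrite /= ?half ?Rehm//; have := cabs_ge0 (b - z0); lra.
have Sc' : S ((z0 + c) / 2).
  by split; rewrite /= ?half ?Rehm//; have := cabs_ge0 (c - z0); lra.
have Sm : S ((b + c) / 2) by exact: mS.
have e4 : 0 < e / 4 by rewrite divr_gt0.
have [N1 h1] := goursat mS lS dS Sb Sm Sb' e4.
have [N2 h2] := goursat mS lS dS Sc Sc' Sm e4.
have [N3 h3] := goursat mS lS dS Sm Sc' Sb' e4.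
exists (maxn (maxn N0 N1) (maxn N2 N3)).+1 => -[//|n].
rewrite ltnS !geq_max => /andP[/andP[n0 n1] /andP[n2 n3]].
rewrite tri_sum_split.
move: (h0N _ n0) (h1 _ n1) (h2 _ n2) (h3 _ n3).
have -> : perimeter z0 ((z0 + b) / 2) ((z0 + c) / 2) = perimeter z0 b c / 2.
  rewrite /perimeter half (cabsC z0) half (cabsC z0).
  have -> : (z0 + c) / 2 - (z0 + b) / 2 = (c - b) / 2 by field.
  by rewrite cabs_half; lra.
have -> : perimeter z0 b c / (2 * 2 ^+ k) = perimeter z0 b c / 2 / 2 ^+ k.
  by rewrite invfM mulrA.
set q := M * _.
set A := tri_sum _ _ _ _ _; set B := tri_sum _ _ _ _ _.
set D := tri_sum _ _ _ _ _; set E := tri_sum _ _ _ _ _.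
have := cabsD (A + B + D) E; have := cabsD (A + B) D; have := cabsD A B.
lra.
Qed.

(** The remaining corner can be made as small as desired. *)
Lemma goursat_vertex g u z0 s h M d b c e : 0 < h -> 0 < d -> 0 <= M ->
  (forall z, cabs (z - z0) <= s -> z != z0 -> derivable g z 1) ->
  (forall z, cabs (z - z0) <= d -> cabs (g z) <= M) ->
  0 < e -> cabs (b - z0) <= s -> cabs (c - z0) <= s ->
  h <= complex.Re (u * (b - z0)) -> h <= complex.Re (u * (c - z0)) ->
  exists N, forall n, (N <= n)%N -> cabs (tri_sum g n z0 b c) <= e.
Proof.
move=> h0 d0 M0 dg gM e0 bs cs bh ch.
have s0 : 0 <= s := le_trans (cabs_ge0 _) bs.
have e2 : 0 < e / 2 by rewrite divr_gt0.
have P0 : 0 <= M * perimeter z0 b c by rewrite mulr_ge0 ?perimeter_ge0.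
have [k hk] := halfpow_small (M * perimeter z0 b c / (e / 2) + s / d) ltr01.
have k0 : 0 < 2 ^+ k :> R by rewrite exprn_gt0.
have k1 : 1 <= 2 ^+ k :> R by rewrite exprn_ege1// ler1n.
have hd : s <= 2 ^+ k * d.
  rewrite -ler_pdivrMr//; move: hk; rewrite ltr_pdivrMr//.
  by have := divr_ge0 P0 (ltW e2); lra.
have hP : M * (perimeter z0 b c / 2 ^+ k) <= e / 2.
  rewrite mulrA ler_pdivrMr// (mulrC (e / 2)) -ler_pdivrMr//; move: hk.
  by rewrite ltr_pdivrMr//; have := divr_ge0 s0 (ltW d0); lra.
have [||||N hN] := @goursat_corner g u z0 s h M d k h0 d0 M0 dg gM b c _ e2 bs cs.
- exact: le_trans hd.
- exact: le_trans hd.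
- exact: le_trans bh (ler_peMl (le_trans (ltW h0) bh) k1).
- exact: le_trans ch (ler_peMl (le_trans (ltW h0) ch) k1).
by exists N => n /hN; lra.
Qed.

(** A lower bound for a sum along a segment of direction w, obtained from the sign
of an imaginary part; it replaces the computation of the integral of 1 / z. *)
Lemma seg_sum_Im_ge S f (w : C) n a b (t : R) : midpoint_closed S ->
  S a -> S b -> 0 <= t -> b - a = t%:C%C * w ->
  (forall z, S z -> 1 <= complex.Im (w * f z)) ->
  t <= complex.Im (seg_sum f n a b).
Proof.
move=> mS + + + + fw; elim: n a b t => [|n IH] a b t Sa Sb t0 ba /=.
  rewrite ba -mulrA cImM/= mul0r addr0.
  rewrite -[leLHS]mulr1 ler_wpM2l// mulrA mulrDr.
  have e := half_half (w * f a + w * f b).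
  have := congr1 (@complex.Im R) e; rewrite cImD.
  by have := fw _ Sa; have := fw _ Sb; rewrite !cImD; lra.
have t2 : ((t / 2)%:C%C : C) = t%:C%C / 2.
  by rewrite rmorphM/= fmorphV/= rmorph_nat.
have h1 := IH a ((a + b) / 2) (t / 2) Sa (mS _ _ Sa Sb).
have h2 := IH ((a + b) / 2) b (t / 2) (mS _ _ Sa Sb) Sb.
have : t / 2 <= complex.Im (seg_sum f n a ((a + b) / 2)).
  apply: h1; first by rewrite divr_ge0.
  by rewrite t2 mulrAC -ba; field.
have : t / 2 <= complex.Im (seg_sum f n ((a + b) / 2) b).
  apply: h2; first by rewrite divr_ge0.
  by rewrite t2 mulrAC -ba; field.
by rewrite cImD; lra.
Qed.

End LocalMaximum.

Section AnnulusMaximum.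
Variable R : realType.
Local Notation C := (Cfield R).
Implicit Types (f g : C -> C) (S : set C) (a b c u v z : C) (s h e m d : R).

(** The value at c makes the quotient continuous when f is differentiable at c. *)
Definition diff_quot f c z : C :=
  if z == c then 'D_1 f c else (f z - f c) / (z - c).

Lemma diff_quot_bounded f c : derivable f c 1 ->
  exists d M, [/\ 0 < d, 0 <= M &
    forall z, cabs (z - c) <= d -> cabs (diff_quot f c z) <= M].
Proof.
move=> /derivable_approx /(_ 1 ltr01)[d d0]; set l := 'D_1 f c => hd.
exists (d / 2), (cabs l + 1 + cabs l); split.
- by rewrite divr_gt0.
- by rewrite !addr_ge0 ?cabs_ge0.
move=> z zd; rewrite /diff_quot; have [_|zc] := eqVneq z c.
  by rewrite lerDr addr_ge0 ?cabs_ge0.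
apply: (@le_trans _ _ (cabs l + 1)); last by rewrite lerDl cabs_ge0.
have zc0 : z - c != 0 by rewrite subr_eq0.
have zc1 : 0 < cabs (z - c) by rewrite cabs_gt0.
rewrite cabsM cabsV ler_pdivrMr//.
have := hd z (le_lt_trans zd _); rewrite ltr_pdivrMr ?ltr_pMr// => /(_ ltac:(lra)).
have := cabsD (f z - f c - l * (z - c)) (l * (z - c)); rewrite subrK cabsM; lra.
Qed.

Lemma derivable_quot f (k : C) c z : z != c -> derivable f z 1 ->
  derivable (fun w => (f w - k) / (w - c)) z 1.
Proof.
move=> zc df; apply: derivable_pmul.
  by apply: derivable_psub; [exact: df|exact: derivable_pcst].
apply: derivable_pinv; first by rewrite subr_eq0.
by apply: derivable_psub; [exact: derivable_pid|exact: derivable_pcst].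
Qed.

Lemma near_neq (z c : C) : z != c -> \forall w \near z, w != c.
Proof.
move=> zc; apply/nbhs_ballP; exists `|z - c|; rewrite /= ?normr_gt0 ?subr_eq0//.
by move=> w; rewrite -ball_normE /=; apply: contraTneq => ->; rewrite ltxx.
Qed.

Lemma derivable_diff_quot f c z : z != c -> derivable f z 1 ->
  derivable (diff_quot f c) z 1.
Proof.
move=> zc df; have h := derivable_quot (k := f c) zc df.
refine (derivable_near _ h).
by apply: filterS (near_neq zc) => w /negPf wc; rewrite /diff_quot wc.
Qed.

(** The part in a disk of the line through z0 + s v and z0 + s i v.  When v ranges
over the fourth roots of unity, these lines carry the sides of a square around
z0.  The equation of the line is split into two half-planes because half-planes
are midpoint-closed. *)
Let side z0 s v : set C := [set z | cabs (z - z0) <= s] `&`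
  ([set z | s <= complex.Re ((1 - 'i%C) * v^*%C * (z - z0))] `&`
   [set z | - s <= complex.Re (- ((1 - 'i%C) * v^*%C) * (z - z0))]).

Let side_midpoint z0 s v : midpoint_closed (side z0 s v).
Proof.
apply: setI_midpoint_closed; first exact: disc_midpoint_closed.
by apply: setI_midpoint_closed; exact: halfplane_midpoint_closed.
Qed.

Let sideP z0 s v z : cabs v = 1 -> side z0 s v z ->
  exists x y, [/\ x + y = s, z - z0 = v * (x +i* y)%C & x ^+ 2 + y ^+ 2 <= s ^+ 2].
Proof.
move=> v1 [/= h1 [h2 h3]].
pose w : C := v^*%C * (z - z0).
have vw : z - z0 = v * w.
  by rewrite /w mulrA mul_conj v1 expr1n mul1r.
have ws : cabs w = cabs (z - z0) by rewrite /w cabsM cabs_conj v1 mul1r.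
move: h2 h3; rewrite mulNr -!mulrA -/w; move: (w) vw ws => {}w vw ws h2 h3.
exists (complex.Re w), (complex.Im w); split.
- move: h2 h3; rewrite cReN mulrBl mul1r cReD cReN cReM /=.
  by rewrite mul0r mul1r sub0r; lra.
- by rewrite vw; case: (w).
- by rewrite -cabs_sq ws ler_pXn2r// nnegrE ?cabs_ge0// (le_trans (cabs_ge0 _) h1).
Qed.

Let side_start z0 s v : 0 <= s -> cabs v = 1 -> side z0 s v (z0 + s%:C%C * v).
Proof.
move=> s0 v1; have e : z0 + s%:C%C * v - z0 = s%:C%C * v by ring.
have e2 : (1 - 'i%C) * v^*%C * (s%:C%C * v) = s%:C%C * (1 - 'i%C : C).
  have := mul_conj v; rewrite v1 expr1n => vv.
  by rewrite mulrACA [_ * v]mulrC vv mulr1 mulrC.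
have r : complex.Re (s%:C%C * (1 - 'i%C : C)) = s.
  by rewrite cReM /=; lra.
by split; [|split]; rewrite /= e ?mulNr ?e2 ?cReN ?r// cabsM v1 mulr1 cabs_real ger0_norm.
Qed.

Let side_end z0 s v : 0 <= s -> cabs v = 1 -> side z0 s v (z0 + s%:C%C * ('i%C * v)).
Proof.
move=> s0 v1; have e : z0 + s%:C%C * ('i%C * v) - z0 = s%:C%C * ('i%C * v) by ring.
have e2 : (1 - 'i%C) * v^*%C * (s%:C%C * ('i%C * v)) = s%:C%C * ((1 - 'i%C) * 'i%C : C).
  have := mul_conj v; rewrite v1 expr1n => vv.
  transitivity (s%:C%C * ((1 - 'i%C) * 'i%C) * (v * v^*%C)); first by ring.
  by rewrite vv mulr1.
have r : complex.Re (s%:C%C * ((1 - 'i%C) * 'i%C : C)) = s.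
  by rewrite !cReM /=; lra.
have i1 : cabs ('i%C : C) = 1 by rewrite cabs_sqrt /= expr0n add0r expr1n sqrtr1.
split; [|split]; rewrite /= e ?mulNr ?e2 ?cReN ?r//.
by rewrite !cabsM i1 v1 !mulr1 cabs_real ger0_norm.
Qed.

Let side_norm z0 s v z : 0 <= s -> cabs v = 1 -> side z0 s v z ->
  s / 2 <= cabs (z - z0) <= s.
Proof.
move=> s0 v1 zs; apply/andP; split; last by case: zs.
have [x [y [xy -> xy2]]] := sideP v1 zs.
rewrite cabsM v1 mul1r -(@ler_pXn2r _ 2)// ?nnegrE ?cabs_ge0 ?divr_ge0//.
by rewrite cabs_sq /= -xy; have := sqr_ge0 (x - y);
  have := sqr_ge0 x; have := sqr_ge0 y; rewrite !expr2; lra.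
Qed.

Let side_angle z0 s v z : 0 < s -> cabs v = 1 -> side z0 s v z ->
  1 <= complex.Im (s%:C%C * ('i%C - 1) * v * (z - z0)^-1).
Proof.
move=> s0 v1 zs; have [x [y [xy zE xy2]]] := sideP v1 zs.
have v0 : v != 0 by rewrite -cabs_eq0 v1 oner_eq0.
have -> : s%:C%C * ('i%C - 1) * v * (z - z0)^-1 =
    s%:C%C * (('i%C - 1) * (x +i* y)%C^-1).
  by rewrite zE invfM mulrA -[_ * v * v^-1]mulrA divff// mulr1 mulrA.
have xy0 : 0 < x ^+ 2 + y ^+ 2.
  by have := mulr_gt0 s0 s0; rewrite -xy; have := sqr_ge0 (x - y); rewrite !expr2; lra.
rewrite !cImM /= !(mul0r, mulr0, addr0, add0r, subr0, oppr0, sub0r).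
set n := x ^+ 2 + y ^+ 2 in xy0 xy2 *.
have -> : s * (-1 * - (y / n) + 1 * (x / n)) = s ^+ 2 / n.
  by rewrite -xy; field; rewrite gt_eqF.
by rewrite ler_pdivlMr// mul1r.
Qed.

(** Cauchy's formula with a non-optimal constant: Goursat's theorem for the
difference quotient of f at z0, on the four triangles that join z0 to the sides
of the square, compares f z0 times the sum of 1 / (z - z0) around the square to
the sum of f z / (z - z0); each side contributes at least 1 to the imaginary
part of the former. *)
Lemma annulus_bound f z0 s m : 0 < s ->
  (forall z, cabs (z - z0) <= s -> derivable f z 1) ->
  (forall z, s / 2 <= cabs (z - z0) <= s -> cabs (f z) <= m) ->
  cabs (f z0) <= 4 * m.
Proof.
move=> s0 df fm; have s0' := ltW s0.
have [|d [M [d0 M0 gM]]] := @diff_quot_bounded f z0.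
  by apply: df; rewrite subrr cabs0.
pose g := diff_quot f z0.
have dg z : cabs (z - z0) <= s -> z != z0 -> derivable g z 1.
  by move=> zs zz; apply: derivable_diff_quot => //; exact: df.
apply/ler_addgt0Pr => e e0.
pose p v : C := z0 + s%:C%C * v.
have i1 : cabs ('i%C : C) = 1 by rewrite cabs_sqrt /= expr0n add0r expr1n sqrtr1.
have tri v : cabs v = 1 -> exists N, forall n, (N <= n)%N ->
    cabs (tri_sum g n z0 (p v) (p ('i%C * v))) <= e.
  move=> v1; pose b := p v; pose c := p ('i%C * v).
  have bs := side_start z0 s0' v1; have cs := side_end z0 s0' v1.
  apply: (@goursat_vertex R g ((1 - 'i%C) * v^*%C) z0 s s M d) => //.
  - by case: bs.
  - by case: cs.
  - by case: bs => _ [].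
  - by case: cs => _ [].
(* On the sides, g = F - f z0 * G. *)
pose F z : C := f z / (z - z0); pose G z : C := (z - z0)^-1.
have fm0 : 0 <= m.
  apply: le_trans (fm (p 1) _); first exact: cabs_ge0.
  have -> : p 1 - z0 = s%:C%C by rewrite /p; ring.
  by rewrite cabs_real ger0_norm// lexx andbT; lra.
have sumF v n : cabs v = 1 -> cabs (seg_sum F n (p v) (p ('i%C * v))) <= 4 * m.
  move=> v1; have bs := side_start z0 s0' v1; have cs := side_end z0 s0' v1.
  apply: le_trans (seg_sum_bound (m := m / (s / 2)) n (@side_midpoint z0 s v) bs cs _) _.
    move=> z zs; have zn := side_norm s0' v1 zs.
    have /andP[z1 z2] := zn; rewrite /F cabsM cabsV.
    have z0' : 0 < cabs (z - z0) by lra.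
    rewrite ler_pM ?invr_ge0 ?cabs_ge0//; first exact: fm.
    by rewrite lef_pV2// posrE; lra.
  have -> : p ('i%C * v) - p v = s%:C%C * ('i%C * v - v) by rewrite /p; ring.
  rewrite cabsM cabs_real ger0_norm//.
  have : cabs ('i%C * v - v) <= 2 by have := cabsB ('i%C * v) v; rewrite cabsM i1 v1; lra.
  move=> h; apply: (@le_trans _ _ (m / (s / 2) * (s * 2))).
    by rewrite ler_wpM2l ?divr_ge0// ler_wpM2l.
  have -> // : m / (s / 2) * (s * 2) = 4 * m by field; rewrite gt_eqF.
have sumG v n : cabs v = 1 -> 1 <= complex.Im (seg_sum G n (p v) (p ('i%C * v))).
  move=> v1; have bs := side_start z0 s0' v1; have cs := side_end z0 s0' v1.
  apply: (seg_sum_Im_ge n (@side_midpoint z0 s v) bs cs ler01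
    (w := s%:C%C * ('i%C - 1) * v)).
    by rewrite mul1r /p; ring.
  by move=> z zs; exact: side_angle s0 v1 zs.
have sumg v n : cabs v = 1 -> seg_sum g n (p v) (p ('i%C * v)) =
    seg_sum F n (p v) (p ('i%C * v)) - f z0 * seg_sum G n (p v) (p ('i%C * v)).
  move=> v1; have bs := side_start z0 s0' v1; have cs := side_end z0 s0' v1.
  rewrite -mulNr -seg_sum_comb.
  apply: (seg_sum_eq n (@side_midpoint z0 s v) bs cs) => z zs.
  rewrite /g /diff_quot /F /G; case: eqP => [zz|_]; last by ring.
  by have := side_norm s0' v1 zs; rewrite zz subrr cabs0 => ?; exfalso; lra.
have im1 : cabs (- 'i%C : C) = 1 by rewrite cabsN.
have m1 : cabs (-1 : C) = 1 by rewrite cabsN cabs1.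
have ii : 'i%C * 'i%C = -1 :> C by rewrite -expr2; exact: sqr_i.
have [N1 h1] := tri 1 (cabs1 R); have [N2 h2] := tri 'i%C i1.
have [N3 h3] := tri (-1) m1; have [N4 h4] := tri (- 'i%C) im1.
pose n := maxn (maxn N1 N2) (maxn N3 N4).
have hn : (n <= n)%N by [].
move: (hn); rewrite {1}/n !geq_max => /andP[/andP[n1 n2] /andP[n3 n4]].
move: (h1 _ n1) (h2 _ n2) (h3 _ n3) (h4 _ n4); rewrite /tri_sum.
have := sumg 1 n (cabs1 R); have := sumg 'i%C n i1.
have := sumg (-1) n m1; have := sumg (- 'i%C) n im1.
have := sumF 1 n (cabs1 R); have := sumF 'i%C n i1.
have := sumF (-1) n m1; have := sumF (- 'i%C) n im1.
have := sumG 1 n (cabs1 R); have := sumG 'i%C n i1.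
have := sumG (-1) n m1; have := sumG (- 'i%C) n im1.
have -> : 'i%C * (-1) = - 'i%C :> C by ring.
have -> : 'i%C * (- 'i%C) = 1 :> C by rewrite mulrN ii opprK.
rewrite mulr1 ii.
rewrite (seg_sumC g n z0 (p 'i%C)) (seg_sumC g n z0 (p (-1))).
rewrite (seg_sumC g n z0 (p (- 'i%C))) (seg_sumC g n z0 (p 1)).
set F1 := seg_sum F n (p 1) _; set F2 := seg_sum F n (p 'i%C) _.
set F3 := seg_sum F n (p (-1)) _; set F4 := seg_sum F n (p (- 'i%C)) _.
set G1 := seg_sum G n (p 1) _; set G2 := seg_sum G n (p 'i%C) _.
set G3 := seg_sum G n (p (-1)) _; set G4 := seg_sum G n (p (- 'i%C)) _.
set s1 := seg_sum g n z0 _; set s2 := seg_sum g n z0 _.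
set s3 := seg_sum g n z0 _; set s4 := seg_sum g n z0 _.
move=> I4 I3 I2 I1 A4 A3 A2 A1 -> -> -> ->.
set T1 := s1 + _ + _; set T2 := s2 + _ + _.
set T3 := s3 + _ + _; set T4 := s4 + _ + _ => t1 t2 t3 t4.
(* The sums along the segments from z0 to the vertices cancel. *)
have key : f z0 * (G1 + G2 + G3 + G4) =
    F1 + F2 + F3 + F4 - (T1 + T2 + T3 + T4).
  by rewrite /T1 /T2 /T3 /T4; ring.
have G4le : 4 <= cabs (G1 + G2 + G3 + G4).
  apply: le_trans (Im_le _); rewrite !cImD.
  by apply: le_trans (ler_norm _); lra.
have := congr1 (@cabs R) key; rewrite cabsM => key2.
have := cabsB (F1 + F2 + F3 + F4) (T1 + T2 + T3 + T4).
have := cabsD (F1 + F2 + F3) F4; have := cabsD (F1 + F2) F3; have := cabsD F1 F2.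
have := cabsD (T1 + T2 + T3) T4; have := cabsD (T1 + T2) T3; have := cabsD T1 T2.
have := ler_wpM2l (cabs_ge0 (f z0)) G4le; rewrite key2.
lra.
Qed.

(** The constant in the previous bound disappears when it is applied to the
powers of f. *)
Lemma annulus_maximum f z0 s m : 0 < s ->
  (forall z, cabs (z - z0) <= s -> derivable f z 1) ->
  (forall z, s / 2 <= cabs (z - z0) <= s -> cabs (f z) <= m) ->
  cabs (f z0) <= m.
Proof.
move=> s0 df fm.
have m0 : 0 <= m.
  apply: le_trans (fm (z0 + s%:C%C) _); first exact: cabs_ge0.
  rewrite addrAC subrr add0r cabs_real ger0_norm ?(ltW s0)// lexx andbT.
  by lra.
apply: (@pow_le R _ _ 4) => // [|n]; first exact: cabs_ge0.
rewrite -cabsX; apply: (@annulus_bound (fun w => f w ^+ n)) s0 _ _ => z zs.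
  exact: derivable_pexp (df z zs).
by rewrite cabsX lerXn2r ?nnegrE ?cabs_ge0//; exact: fm.
Qed.

End AnnulusMaximum.

(** * The maximum principle *)

Section Disk.
Variable R : realType.
Local Notation C := (Cfield R).
Local Notation D := (@closed_disk C).
Implicit Types (f g h : C -> C) (a b c u v z w : C) (e m d r : R) (es : seq C).

Lemma in_disk z : D z <-> cabs z <= 1.
Proof. by rewrite /closed_disk /= cabsE lecC. Qed.

Lemma in_open_disk z : (`|z| < 1) = (cabs z < 1).
Proof. by rewrite cabsE ltcC. Qed.

Definition disk_cont f := forall z, cabs z <= 1 ->
  f w @[w --> within D (nbhs z)] --> f z.

Lemma cvg_within_eps f z (l : C) :
  (f w @[w --> within D (nbhs z)] --> l) <->
  (forall e, 0 < e -> exists2 d, 0 < d & forall w, cabs w <= 1 ->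
    cabs (w - z) < d -> cabs (f w - l) < e).
Proof.
split => [cf e e0|h].
  have := iffLR (@cvgrPdist_lt C C _ (within D (nbhs z))
    (within_filter D (nbhs_filter z)) _ l) cf.
  move=> /(_ (e%:C%C : C)); rewrite ltcC => /(_ e0) /nbhs_ballP[d /= d0 hd].
  pose dr := complex.Re d.
  have dE : d = dr%:C%C by rewrite RRe_real// gtr0_real.
  exists dr; first by rewrite -ltcC -dE.
  move=> w /in_disk Dw wz; have := hd w; rewrite -ball_normE /= cabsE dE ltcC.
  by rewrite (cabsC z) wz => /(_ isT Dw); rewrite cabsE ltcC (cabsC l).
apply: (iffRL (@cvgrPdist_lt C C _ (within D (nbhs z))
  (within_filter D (nbhs_filter z)) _ l)) => e e0.
have eE : e = (complex.Re e)%:C%C by rewrite RRe_real// gtr0_real.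
have e1 : 0 < complex.Re e by rewrite -ltcC -eE.
have [d d0 hd] := h _ e1.
apply/nbhs_ballP; exists (d%:C%C : C); first by rewrite /= ltcC.
move=> w; rewrite -ball_normE /= cabsE ltcC (cabsC z) => wz /in_disk Dw.
by rewrite cabsE eE ltcC cabsC; exact: hd.
Qed.

Lemma disk_contP f : disk_cont f <->
  {within D, continuous f}.
Proof.
split=> cf; first by apply/subspace_continuousP => z /in_disk; exact: cf.
by move=> z /in_disk; apply/subspace_continuousP : z.
Qed.

(** The list es records points where differentiability is not known; it turns out
that there are no singularities at such points. *)
Definition holo_off es f := disk_cont f /\
  forall z, cabs z < 1 -> z \notin es -> derivable f z 1.

Lemma holo_pcst es (k : C) : holo_off es (fun=> k).
Proof.
by split => [z _|z _ _]; [exact: cvg_cst|exact: derivable_pcst].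
Qed.

Lemma holo_pid es : holo_off es (fun z => z).
Proof.
by split => [z _|z _ _]; [exact: cvg_within|exact: derivable_pid].
Qed.

Lemma holo_psub es f g : holo_off es f -> holo_off es g ->
  holo_off es (fun z => f z - g z).
Proof.
move=> [cf df] [cg dg]; split => [z z1|z z1 zes].
  exact: (@cvgB C C _ (within D (nbhs z)) _ f g _ _ (cf z z1) (cg z z1)).
exact: derivable_psub (df z z1 zes) (dg z z1 zes).
Qed.

Lemma holo_pmul es f g : holo_off es f -> holo_off es g ->
  holo_off es (fun z => f z * g z).
Proof.
move=> [cf df] [cg dg]; split => [z z1|z z1 zes].
  exact: (@cvgM C _ (within D (nbhs z)) _ f g _ _ (cf z z1) (cg z z1)).
exact: derivable_pmul (df z z1 zes) (dg z z1 zes).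
Qed.

Lemma holo_pexp es f n : holo_off es f -> holo_off es (fun z => f z ^+ n).
Proof.
move=> hf; elim: n => [|n IH]; first exact: holo_pcst.
have -> : (fun z => f z ^+ n.+1) = (fun z => f z * f z ^+ n).
  by apply/funext => z; rewrite exprS.
exact: holo_pmul.
Qed.

Lemma holo_pinv es f : (forall z, cabs z <= 1 -> f z != 0) -> holo_off es f ->
  holo_off es (fun z => (f z)^-1).
Proof.
move=> f0 [cf df]; split => [z z1|z z1 zes].
  exact: (@cvgV C _ (within D (nbhs z)) _ f _ (f0 z z1) (cf z z1)).
exact: derivable_pinv (f0 z (ltW z1)) (df z z1 zes).
Qed.

Lemma disk_nonempty : D !=set0.
Proof. by exists 0; exact: disk0. Qed.

Lemma disk_EVT (psi : C -> R) : {within D, continuous psi} ->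
  exists2 c, cabs c <= 1 & forall z, cabs z <= 1 -> psi z <= psi c.
Proof.
move=> cpsi; have [c Dc hc] :=
  compact_EVT_max disk_nonempty (@disk_compact R) cpsi.
exists c; first by apply/in_disk; rewrite -inE.
by move=> z /in_disk Dz; apply: hc; rewrite inE.
Qed.

Lemma cabs_within f : disk_cont f -> {within D, continuous (@cabs R \o f)}.
Proof.
move=> /disk_contP cf; apply: within_continuous_comp => //.
by move=> z _; exact: cabs_continuous.
Qed.

Lemma disk_cont_bounded f : disk_cont f ->
  exists2 m, 0 <= m & forall z, cabs z <= 1 -> cabs (f z) <= m.
Proof.
move=> /cabs_within /disk_EVT[c c1 hc].
by exists (cabs (f c)) => //; exact: cabs_ge0.
Qed.

(** Here q A = e in the notation of the maximum principle below: the left-hand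
side bounds |f z (1 + k (z - c))|^2, with n = |z - c|^2, Q = |c|^2 and
x = Re (c^* (z - c)). *)
Let perturbation_bound (A q Q n x : R) : 0 < A -> 0 <= q -> q <= 1 / 15 ->
  0 <= Q -> Q <= 1 -> 0 <= n -> -1 <= x -> x <= 1 ->
  (A - 2 * (q * A) * x - (q * A) * n) * (1 + 2 * q * x + q ^+ 2 * Q * n) <=
    A * (1 - q * n / 2).
Proof.
move=> A0 q0 q1 Q0 Q1 n0 x0 x1.
rewrite -subr_ge0.
have -> : A * (1 - q * n / 2) -
  (A - 2 * (q * A) * x - (q * A) * n) * (1 + 2 * q * x + q ^+ 2 * Q * n) =
  A * (q * n * (1 / 2 - q * Q + 2 * q ^+ 2 * Q * x + 2 * q * x) +
       (2 * q * x) ^+ 2 + q * q ^+ 2 * Q * n ^+ 2) by field.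
have qQ : 0 <= q * Q <= 1 / 15 by nra.
have qQx : - (1 / 15) <= q * Q * x <= 1 / 15 by nra.
have qx : - (1 / 15) <= q * x <= 1 / 15 by nra.
have qqQx : - (1 / 225) <= q * (q * Q * x) <= 1 / 225 by nra.
have h : 0 <= 1 / 2 - q * Q + 2 * q ^+ 2 * Q * x + 2 * q * x.
  by rewrite expr2; lra.
have q2 : 0 <= q * q ^+ 2 by rewrite mulr_ge0 ?sqr_ge0.
apply: mulr_ge0; first exact: ltW.
apply: addr_ge0; last by rewrite !mulr_ge0 ?sqr_ge0.
by rewrite addr_ge0 ?sqr_ge0// mulr_ge0// mulr_ge0.
Qed.

(** If |f| exceeds its maximum on the circle, then |f|^2 + e |z|^2 is maximal at
an interior point c for small e.  Near c, multiplying f by the affine function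
1 + k (z - c) with k = e c^* / |f c|^2 cancels the first-order term, and leaves a
function whose modulus is strictly smaller on an annulus around c than at c. *)
Lemma maximum_principle f m : holo_off [::] f ->
  (forall z, cabs z = 1 -> cabs (f z) <= m) ->
  forall z, cabs z <= 1 -> cabs (f z) <= m.
Proof.
move=> [cf df] fm z1 z1D; rewrite leNgt; apply/negP => mz1.
have m0 : 0 <= m := le_trans (cabs_ge0 _) (fm 1 (cabs1 R)).
pose A1 := cabs (f z1) ^+ 2.
have A1m : m ^+ 2 < A1 by rewrite ltrXn2r// nnegrE ?cabs_ge0.
have m2 : 0 <= m ^+ 2 by rewrite sqr_ge0.
pose e := Num.min ((A1 - m ^+ 2) / 2) (A1 / 16).
have e0 : 0 < e by rewrite lt_min; apply/andP; split; lra.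
have e1 : e <= (A1 - m ^+ 2) / 2 by rewrite ge_min lexx.
have e2 : e <= A1 / 16 by rewrite ge_min lexx orbT.
clearbody e.
pose psi z : R := cabs (f z) ^+ 2 + e * cabs z ^+ 2.
have [|c c1 hc] := @disk_EVT psi.
  have cw := cabs_within cf; move=> z; have cz := cw z.
  have c2 : {for z, continuous (@cabs R : subspace D -> R)}.
    exact: (@continuous_subspaceT _ _ D _ (@cabs_continuous R)).
  apply: (@cvgD R R _ (nbhs (z : subspace D)) _ (fun z => cabs (f z) ^+ 2)
    (fun z => e * cabs z ^+ 2)).
    exact: (@cvgM R _ (nbhs (z : subspace D)) _ _ _ _ _ cz cz).
  apply: (@cvgM R _ (nbhs (z : subspace D)) _ (fun=> e)); first exact: cvg_cst.
  exact: (@cvgM R _ (nbhs (z : subspace D)) _ _ _ _ _ c2 c2).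
have psic : A1 <= psi c.
  by apply: le_trans (hc _ z1D); rewrite lerDl mulr_ge0 ?sqr_ge0// ltW.
have cc2 : cabs c ^+ 2 <= 1 by rewrite exprn_ile1// cabs_ge0.
have cc0 : 0 <= cabs c ^+ 2 by rewrite sqr_ge0.
pose A := cabs (f c) ^+ 2.
have Ae : 15 * e <= A by move: psic; rewrite /psi -/A; nra.
have A0 : 0 < A by lra.
(* On the circle psi is at most m ^+ 2 + e < A1. *)
have clt1 : cabs c < 1.
  rewrite lt_neqAle c1 andbT; apply/eqP => cc1.
  move: psic; rewrite /psi cc1 expr1n mulr1.
  have : cabs (f c) ^+ 2 <= m ^+ 2 by rewrite lerXn2r ?nnegrE ?cabs_ge0// fm.
  by lra.
pose s := (1 - cabs c) / 2.
have s0 : 0 < s by rewrite divr_gt0// subr_gt0.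
have s1 : s <= 1 by rewrite /s; have := cabs_ge0 c; lra.
pose q := e / A.
have qA : q * A = e by rewrite /q mulrVK// unitfE gt_eqF.
have q0 : 0 <= q by rewrite divr_ge0 ?ltW.
have q15 : q <= 1 / 15 by rewrite ler_pdivrMr//; lra.
pose k : C := q%:C%C * c^*%C.
pose F z : C := f z * (1 + k * (z - c)).
have bound z : s / 2 <= cabs (z - c) <= s ->
    cabs (F z) ^+ 2 <= A - e * s ^+ 2 / 8.
  move=> /andP[zs1 zs2].
  have zD : cabs z <= 1.
    by have := cabsD (z - c) c; rewrite subrK; move: zs2; rewrite /s; lra.
  pose x := complex.Re (c^*%C * (z - c)); pose n := cabs (z - c) ^+ 2.
  have n0 : 0 <= n by rewrite sqr_ge0.
  have ns : s ^+ 2 / 4 <= n.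
    have -> : s ^+ 2 / 4 = (s / 2) ^+ 2 by field.
    by rewrite lerXn2r// nnegrE ?cabs_ge0// divr_ge0// ltW.
  have x1 : -1 <= x <= 1.
    rewrite -ler_norml; apply: le_trans (Re_le _) _.
    rewrite cabsM cabs_conj; apply: mulr_ile1; rewrite ?cabs_ge0//.
    exact: le_trans s1.
  have zn : cabs z ^+ 2 = cabs c ^+ 2 + 2 * x + n.
    rewrite /x /n !cabs_sq; case: (z) (c) => [a b] [a' b'] /=; ring.
  have wn : cabs (1 + k * (z - c)) ^+ 2 =
      1 + 2 * q * x + q ^+ 2 * cabs c ^+ 2 * n.
    rewrite /x /n /k !cabs_sq; case: (z) (c) => [a b] [a' b'] /=; ring.
  have fz : cabs (f z) ^+ 2 <= A - 2 * (q * A) * x - q * A * n.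
    by have := hc z zD; rewrite /psi zn qA -/A; lra.
  rewrite /F cabsM exprMn wn; apply: (@le_trans _ _ (A * (1 - q * n / 2))).
    apply: le_trans (perturbation_bound (Q := cabs c ^+ 2) (n := n) (x := x)
      _ _ _ _ _ _ _ _) => //.
    - by rewrite ler_wpM2r// -wn sqr_ge0.
    - by case/andP: x1.
    - by case/andP: x1.
  have -> : A * (1 - q * n / 2) = A - q * A * n / 2 by field.
  rewrite qA; have := ler_wpM2l (ltW e0) ns; lra.
have B0 : 0 <= A - e * s ^+ 2 / 8.
  apply: le_trans (bound (c + s%:C%C) _); first exact: sqr_ge0.
  rewrite addrAC subrr add0r cabs_real ger0_norm ?(ltW s0)// lexx andbT.
  by lra.
have := @annulus_maximum R F c s (Num.sqrt (A - e * s ^+ 2 / 8)) s0.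
have Fc : F c = f c by rewrite /F subrr mulr0 addr0 mulr1.
rewrite Fc => H.
have : cabs (f c) <= Num.sqrt (A - e * s ^+ 2 / 8).
  apply: H => z zs.
    have zD : cabs z < 1.
      have := cabsD (z - c) c; rewrite subrK; move: zs s0; rewrite /s; lra.
    apply: derivable_pmul; first exact: df.
    apply: derivable_padd; first exact: derivable_pcst.
    apply: derivable_pmul; first exact: derivable_pcst.
    by apply: derivable_psub; [exact: derivable_pid|exact: derivable_pcst].
  by rewrite -[leLHS]ger0_norm ?cabs_ge0// -sqrtr_sqr ler_wsqrtr// bound.
have es : 0 < e * s ^+ 2 by rewrite mulr_gt0// exprn_gt0.
rewrite -(@ler_pXn2r _ 2)// ?nnegrE ?cabs_ge0 ?sqrtr_ge0//.
by rewrite sqr_sqrtr// -/A; lra.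
Qed.

End Disk.

(** * Removable singularities *)

Section Removable.
Variable R : realType.
Local Notation C := (Cfield R).
Local Notation D := (@closed_disk C).
Implicit Types (f g h : C -> C) (a b c u v z w : C) (e m d r : R) (es : seq C).

Lemma disk_cont_eps f z e : disk_cont f -> cabs z <= 1 -> 0 < e ->
  exists2 d, 0 < d & forall w, cabs w <= 1 -> cabs (w - z) < d ->
    cabs (f w - f z) < e.
Proof. by move=> cf z1 e0; apply: (iffLR (cvg_within_eps f z (f z)) (cf z z1)). Qed.

Lemma holo_sub_off es es' f : {subset es <= es'} -> holo_off es f -> holo_off es' f.
Proof.
move=> ss [cf df]; split => // z z1 zes; apply: df => //.
exact: contra (ss z) zes.
Qed.

(** A bound passes to the limit.  The last premise on w lets a boundary point be
approached from the interior. *)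
Lemma disk_cont_closure f z m : disk_cont f -> cabs z <= 1 ->
  (forall w, cabs w <= 1 -> w != z -> (cabs z = 1 -> cabs w < 1) -> cabs (f w) <= m) ->
  cabs (f z) <= m.
Proof.
move=> cf z1 fm; apply/ler_addgt0Pr => e e0.
have [d d0 hd] := disk_cont_eps cf z1 e0.
suff [w [w1 wz wd w2]] : exists w,
    [/\ cabs w <= 1, w != z, cabs (w - z) < d & cabs z = 1 -> cabs w < 1].
  have := fm w w1 wz w2; have := hd w w1 wd.
  by have := cabsB (f w) (f w - f z); rewrite subKr; lra.
have [z0|z0] := eqVneq z 0.
  exists (Num.min (d / 2) 1)%:C%C; rewrite z0 cabs0 cabs_real subr0 cabs_real.
  have m0 : 0 < Num.min (d / 2) 1 by rewrite lt_min ltr01 divr_gt0.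
  rewrite ger0_norm ?(ltW m0)//; split.
  - by rewrite ge_min lexx orbT.
  - by rewrite -cabs_gt0 cabs_real normr_gt0 gt_eqF.
  - by rewrite gt_min; apply/orP; left; lra.
  - by move=> /eqP; rewrite eq_sym oner_eq0.
pose t := Num.min (d / 2) (1 / 2).
have t0 : 0 < t by rewrite lt_min; apply/andP; split; lra.
have t1 : t <= 1 / 2 by rewrite ge_min lexx orbT.
have td : t <= d / 2 by rewrite ge_min lexx.
clearbody t.
have zp : 0 < cabs z by rewrite cabs_gt0.
have tz : (1 - t%:C%C) * z - z = - (t%:C%C * z) by ring.
have t2 : 1 - t%:C%C = (1 - t)%:C%C :> C by rewrite rmorphB.
exists ((1 - t%:C%C) * z); split.
- rewrite t2 cabsM cabs_real ger0_norm; last by lra.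
  by nra.
- by rewrite -subr_eq0 tz oppr_eq0 -cabs_gt0 cabsM cabs_real mulr_gt0// normr_gt0 gt_eqF.
- by rewrite tz cabsN cabsM cabs_real ger0_norm ?ltW//; nra.
- by move=> zz; rewrite t2 cabsM cabs_real zz mulr1 ger0_norm; lra.
Qed.

Lemma derivable_mul_vanish f c : cabs c < 1 -> disk_cont f ->
  derivable (fun z => (z - c) * f z) c 1.
Proof.
move=> c1 cf; apply: (@approx_derivable R _ _ (f c)) => e e0.
have [d d0 hd] := disk_cont_eps cf (ltW c1) e0.
exists (Num.min d (1 - cabs c)); first by rewrite lt_min d0 subr_gt0.
move=> w; rewrite lt_min => /andP[wd w1].
have wD : cabs w <= 1 by have := cabsD (w - c) c; rewrite subrK; lra.
have -> : (w - c) * f w - (c - c) * f c - f c * (w - c) = (f w - f c) * (w - c).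
  by ring.
by rewrite cabsM ler_wpM2r ?cabs_ge0// ltW// hd.
Qed.

(** Exceptional points cost nothing: (z - a) * f z ^+ n is holomorphic at a, and
its bound gives the one on f by letting n grow. *)
Lemma maximum_principle_off es f m : holo_off es f ->
  (forall z, cabs z = 1 -> cabs (f z) <= m) ->
  forall z, cabs z <= 1 -> cabs (f z) <= m.
Proof.
elim: es f m => [|a es IH] f m hf fm; first exact: maximum_principle.
have m0 : 0 <= m := le_trans (cabs_ge0 _) (fm 1 (cabs1 R)).
have key z : cabs z <= 1 -> z != a -> cabs (f z) <= m.
  move=> z1 za; have za0 : 0 < cabs (z - a) by rewrite cabs_gt0 subr_eq0.
  apply: (@pow_le R _ _ ((1 + cabs a) / cabs (z - a))) => // [|n].
    exact: cabs_ge0.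
  rewrite mulrAC ler_pdivlMr// mulrC -cabsX -cabsM.
  pose g w := (w - a) * f w ^+ n.
  have hg : holo_off es g.
    have hfn := holo_pexp n hf.
    have [cg dg] := holo_pmul
      (holo_psub (holo_pid (a :: es)) (holo_pcst (a :: es) a)) hfn.
    split => // w w1 wes; have [wa|wa] := eqVneq w a.
      by rewrite wa; apply: derivable_mul_vanish; [rewrite -wa|case: hfn].
    by apply: dg => //; rewrite inE negb_or wa.
  apply: (IH g _ hg) => // w w1; rewrite /g cabsM cabsX ler_pM ?exprn_ge0 ?cabs_ge0//.
    by have := cabsB w a; rewrite w1.
  by rewrite lerXn2r ?nnegrE ?cabs_ge0// fm.
move=> z z1; have [za|za] := eqVneq z a; last exact: key.
apply: disk_cont_closure => //; first by case: hf.
by rewrite za => w w1 wa _; exact: key.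
Qed.

Lemma disk_cont_diff_quot f c : cabs c < 1 -> disk_cont f -> derivable f c 1 ->
  disk_cont (diff_quot f c).
Proof.
move=> c1 cf df z z1; have [zc|zc] := eqVneq z c.
  rewrite zc; apply/cvg_within_eps => e e0.
  have [|d d0 hd] := derivable_approx df (e := e / 2); first by rewrite divr_gt0.
  exists d => // w _ wc; rewrite /diff_quot eqxx; have [wc'|wc'] := eqVneq w c.
    by rewrite subrr cabs0.
  have wc0 : w - c != 0 by rewrite subr_eq0.
  have -> : (f w - f c) / (w - c) - 'D_1 f c =
      (f w - f c - 'D_1 f c * (w - c)) / (w - c) by field.
  rewrite cabsM cabsV ltr_pdivrMr ?cabs_gt0//; apply: le_lt_trans (hd w wc) _.
  by rewrite ltr_pM2r ?cabs_gt0// ltr_pdivrMr// ltr_pMr// ltr1n.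
have h1 : (fun w => (f w - f c) * (w - c)^-1) w @[w --> within D (nbhs z)] -->
    (f z - f c) / (z - c).
  apply: (@cvgM C _ (within D (nbhs z)) _ (fun w => f w - f c) (fun w => (w - c)^-1)).
    apply: (@cvgB C C _ (within D (nbhs z)) _ f (fun=> f c)); first exact: cf.
    exact: cvg_cst.
  apply: (@cvgV C _ (within D (nbhs z)) _ (fun w => w - c)); first by rewrite subr_eq0.
  apply: (@cvgB C C _ (within D (nbhs z)) _ (fun w => w) (fun=> c)).
    exact: cvg_within.
  exact: cvg_cst.
have -> : diff_quot f c z = (f z - f c) / (z - c) by rewrite /diff_quot (negPf zc).
apply: cvg_trans h1; apply: near_eq_cvg.
apply: cvg_within; apply: filterS (near_neq zc) => w /negPf wc.
by rewrite /diff_quot wc.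
Qed.

Lemma holo_diff_quot es f c : cabs c < 1 -> derivable f c 1 -> holo_off es f ->
  holo_off (c :: es) (diff_quot f c).
Proof.
move=> c1 dfc [cf df]; split; first exact: disk_cont_diff_quot.
move=> z z1; rewrite inE negb_or => /andP[zc zes].
exact: derivable_diff_quot zc (df z z1 zes).
Qed.

(** For w and v near c, the maximum principle bounds the difference of the
quotients (h z - h w) / (z - w) and (h z - h v) / (z - v) at z = c by its size on
the unit circle, which tends to 0 with w - v and h w - h v.  Hence the difference
quotients of h at c satisfy Cauchy's criterion. *)
Lemma removable_singularity h c : cabs c < 1 -> holo_off [:: c] h ->
  derivable h c 1.
Proof.
move=> c1 hh; have [ch dh] := hh.
have [H H0 hH] := disk_cont_bounded ch.
pose r := (1 - cabs c) / 2.
have r0 : 0 < r by rewrite divr_gt0// subr_gt0.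
have near_D w : cabs (w - c) < r -> cabs w < 1 - r.
  by have := cabsD (w - c) c; rewrite subrK /r; lra.
clearbody r.
pose phi w := (h w - h c) / (w - c).
have key w v : cabs (w - c) < r -> cabs (v - c) < r -> w != c -> v != c ->
    cabs (phi w - phi v) <=
      (2 * H * cabs (w - v) + 2 * cabs (h w - h v)) / r ^+ 2.
  move=> wr vr wc vc; have w1 := near_D _ wr; have v1 := near_D _ vr.
  have dw : derivable h w 1 by apply: dh; [lra|rewrite inE].
  have dv : derivable h v 1 by apply: dh; [lra|rewrite inE].
  have hw : holo_off [:: w, v & [:: c]] (diff_quot h w).
    have := @holo_diff_quot [:: c] h w _ dw hh.
    move=> /(_ ltac:(lra)); apply: holo_sub_off => x.
    by rewrite !inE => /orP[->//|->]; rewrite !orbT.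
  have hv : holo_off [:: w, v & [:: c]] (diff_quot h v).
    have := @holo_diff_quot [:: c] h v _ dv hh.
    move=> /(_ ltac:(lra)); apply: holo_sub_off => x.
    by rewrite !inE => /orP[->|->]; rewrite !orbT.
  have -> : phi w - phi v = diff_quot h w c - diff_quot h v c.
    rewrite /diff_quot /phi eq_sym (negPf wc) eq_sym (negPf vc).
    by rewrite -[in RHS](opprB w) -[in RHS](opprB v) -[in RHS](opprB (h w))
      -[in RHS](opprB (h v)) !invrN !mulrNN.
  apply: (maximum_principle_off (holo_psub hw hv)); last exact: ltW.
  move=> z z1.
  have far (u : C) : cabs u < 1 - r -> r <= cabs (z - u).
    by have := cabsD (z - u) u; rewrite subrK z1; lra.
  have zw := far _ w1; have zv := far _ v1.
  have zw0 : z - w != 0 by rewrite -cabs_gt0; lra.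
  have zv0 : z - v != 0 by rewrite -cabs_gt0; lra.
  rewrite /diff_quot -subr_eq0 (negPf zw0) -subr_eq0 (negPf zv0).
  have -> : (h z - h w) / (z - w) - (h z - h v) / (z - v) =
      ((h z - h v) * (w - v) - (h w - h v) * (z - v)) / ((z - w) * (z - v)).
    by field; rewrite zw0 zv0.
  rewrite cabsM cabsV (cabsM (z - w)) ler_pM ?invr_ge0 ?mulr_ge0 ?cabs_ge0//.
    apply: le_trans (cabsB _ _) _; rewrite !cabsM; apply: lerD.
      rewrite ler_wpM2r ?cabs_ge0//; apply: le_trans (cabsB _ _) _.
      have := hH z; have := hH v; rewrite z1; move=> /(_ ltac:(lra)) h1 /(_ ltac:(lra)).
      by lra.
    rewrite mulrC ler_wpM2r ?cabs_ge0//; apply: le_trans (cabsB _ _) _.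
    by rewrite z1; lra.
  have zwp : 0 < cabs (z - w) by lra.
  have zvp : 0 < cabs (z - v) by lra.
  rewrite lef_pV2 ?posrE ?mulr_gt0 ?exprn_gt0//.
  by rewrite expr2 ler_pM// ltW.
have osc e : 0 < e -> exists2 d, 0 < d & forall w v,
    cabs (w - c) < d -> cabs (v - c) < d -> w != c -> v != c ->
    cabs (phi w - phi v) <= e.
  move=> e0; pose e' := e * r ^+ 2 / 8.
  have r2 : 0 < r ^+ 2 by rewrite exprn_gt0.
  have e'0 : 0 < e' by rewrite divr_gt0// mulr_gt0.
  have e'E : e * r ^+ 2 = 8 * e' by rewrite /e'; field.
  clearbody e'.
  have H1 : 0 < H + 1 by lra.
  have [d d0 hd] := disk_cont_eps ch (ltW c1) e'0.
  exists (Num.min (Num.min d r) (e' / (H + 1))).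
    by rewrite !lt_min d0 r0 divr_gt0.
  move=> w v; rewrite !lt_min => /andP[/andP[wd wr] wH] /andP[/andP[vd vr] vH] wc vc.
  apply: le_trans (key w v wr vr wc vc) _; rewrite ler_pdivrMr//.
  have hw := hd w; have hv := hd v.
  have {}hw : cabs (h w - h c) < e'.
    by apply: hw => //; have := near_D _ wr; lra.
  have {}hv : cabs (h v - h c) < e'.
    by apply: hv => //; have := near_D _ vr; lra.
  have := cabs_tri (h c) (h w) (h v); rewrite (cabsC (h c)).
  have := cabs_tri c w v; rewrite (cabsC c v).
  move: wH vH; rewrite !ltr_pdivlMr// => wH vH wvd hwv.
  have : H * cabs (w - v) <= 2 * e'.
    have := cabs_ge0 (w - v); have := cabs_ge0 (w - c); have := cabs_ge0 (v - c).
    have := ler_wpM2l H0 wvd; move: wH vH; rewrite !mulrDr !mulr1 ![H * _]mulrC.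
    by lra.
  by rewrite e'E; lra.
have pf : forall d, 0 < d -> c^' [set w | cabs (w - c) < d /\ w != c].
  move=> d d0; apply/nbhs_ballP; exists (d%:C%C : C); first by rewrite /= ltcC.
  by move=> w; rewrite -ball_normE /= cabsE ltcC (cabsC c).
have [|l hl] := @complex_cauchy_lim R C c^' _ phi.
- have [d d0 hd] := osc 1 ltr01; exists 1, [set w | cabs (w - c) < d /\ w != c].
  by split; [exact: pf|move=> w v [? ?] [? ?]; exact: hd].
apply: (@approx_derivable R _ _ l) => e e0.
have [|d d0 hd] := osc (e / 2); first by rewrite divr_gt0.
exists d => // w wd; have [->|wc] := eqVneq w c.
  by rewrite !subrr mulr0 subr0 cabs0 mulr0.
have wc0 : w - c != 0 by rewrite subr_eq0.
have -> : h w - h c - l * (w - c) = (phi w - l) * (w - c) by rewrite /phi; field.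
rewrite cabsM ler_wpM2r ?cabs_ge0// cabsC.
have := hl (e / 2) _ (pf d d0) _ w (conj wd wc).
move=> /(_ (fun w v hw hv => hd w v hw.1 hv.1 hw.2 hv.2)); lra.
Qed.

End Removable.

(** * The disk algebra *)

Section DiskFunctions.
Variable R : realType.
Local Notation C := (Cfield R).
Local Notation D := (@closed_disk C).
Local Notation A := (disk_fun C).
Implicit Types (f g h u : A) (a b c k w z : C) (e m d r : R).

(** The elements of the disk algebra are functions on a subtype; ev f is the
extension by 0, whose argument is an ordinary complex number. *)
Definition ev f z : C := ('valL_ 0 f : C -> C) z.

Lemma ev_val f (z : D) : ev f (val z) = f z.
Proof. exact: valL_disk. Qed.

Lemma ev_holo f : holo_off [::] (ev f).
Proof.
have /asboolP[cf df] := disk_valP f; split.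
  by apply/disk_contP; apply/subspace_valL_continuousP'.
by move=> z z1 _; apply: df; rewrite in_open_disk.
Qed.

Lemma ev_cont f : disk_cont (ev f).
Proof. by case: (ev_holo f). Qed.

Lemma disk_fun_of (F : C -> C) : holo_off [::] F ->
  exists f, forall z, cabs z <= 1 -> ev f z = F z.
Proof.
move=> [cF dF]; pose f0 : D -> C^o := fun z : D => F (val z).
have P : f0 \in @disk_pred C.
  apply/asboolP; split.
    have /disk_contP cF' := cF.
    exact: (iffLR (@subspace_sigL_continuousP C D C F) cF').
  move=> z z1; apply: (@derivable_disk C f0 F) => //.
  by apply: dF => //; rewrite -in_open_disk.
exists (DiskFun P) => z /in_disk Dz.
by rewrite -[z]/(val (SigSub (mem_set Dz) : D)) ev_val.
Qed.

Lemma ev_inj f g : (forall z, cabs z <= 1 -> ev f z = ev g z) -> f = g.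
Proof.
move=> fg; apply/val_inj/funext => z; rewrite /= -!ev_val; apply: fg.
by apply/in_disk; exact: set_mem (valP z).
Qed.

Section Morphism.
Variables (z : C) (z1 : cabs z <= 1).

Let zD : D := SigSub (mem_set (iffRL (in_disk z) z1)).

Let evE f : ev f z = f zD.
Proof. exact: (ev_val f zD). Qed.

Lemma evD f g : ev (f + g) z = ev f z + ev g z.
Proof. by rewrite !evE. Qed.

Lemma evN f : ev (- f) z = - ev f z.
Proof. by rewrite !evE. Qed.

Lemma evB f g : ev (f - g) z = ev f z - ev g z.
Proof. by rewrite evD evN. Qed.

Lemma evM f g : ev (f * g) z = ev f z * ev g z.
Proof. by rewrite !evE. Qed.

Lemma ev1 : ev 1 z = 1.
Proof. by rewrite !evE. Qed.

Lemma ev0 : ev 0 z = 0.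
Proof. by rewrite !evE. Qed.

Lemma evZ k f : ev (k *: f) z = k * ev f z.
Proof. by rewrite !evE. Qed.

Lemma evC k : ev k%:A z = k.
Proof. by rewrite evZ ev1 mulr1. Qed.

Lemma evX f n : ev (f ^+ n) z = ev f z ^+ n.
Proof. by elim: n => [|n IH]; rewrite ?expr0 ?ev1// !exprS evM IH. Qed.

Lemma ev_sum (I : Type) (s : seq I) (P : pred I) (F : I -> A) :
  ev (\sum_(i <- s | P i) F i) z = \sum_(i <- s | P i) ev (F i) z.
Proof.
by elim/big_rec2: _ => [|i x y _ <-]; rewrite ?ev0// evD.
Qed.

End Morphism.

Lemma cabs_le1_0 : cabs (0 : C) <= 1.
Proof. by rewrite cabs0. Qed.

Lemma disk_coord : exists f : A, forall z, cabs z <= 1 -> ev f z = z.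
Proof. by apply: disk_fun_of; exact: holo_pid. Qed.

Definition coord : A := sval (cid disk_coord).

Lemma ev_coord z : cabs z <= 1 -> ev coord z = z.
Proof. exact: (svalP (cid disk_coord)). Qed.

Lemma disk_max f m : (forall z, cabs z = 1 -> cabs (ev f z) <= m) ->
  forall z, cabs z <= 1 -> cabs (ev f z) <= m.
Proof. by move=> h; apply: maximum_principle => //; exact: ev_holo. Qed.

Lemma disk_invertible f : (forall z, cabs z <= 1 -> ev f z != 0) ->
  exists g, f * g = 1.
Proof.
move=> f0; have [g hg] := disk_fun_of (holo_pinv f0 (ev_holo f)).
exists g; apply: ev_inj => z z1; rewrite evM// hg// ev1// mulfV//; exact: f0.
Qed.

Lemma invertible_neq0 f g z : f * g = 1 -> cabs z <= 1 -> ev f z != 0.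
Proof.
move=> fg z1; apply/eqP => f0; have /eqP := congr1 (fun x => ev x z) fg.
by rewrite evM// f0 mul0r ev1// eq_sym oner_eq0.
Qed.

(** Elements of the disk algebra that agree off one point are equal; this allows
cancellation of z - c. *)
Lemma ev_ext f g c : (forall z, cabs z <= 1 -> z != c -> ev f z = ev g z) ->
  f = g.
Proof.
move=> fg; apply: ev_inj => z z1; have [zc|zc] := eqVneq z c; last exact: fg.
apply/eqP; rewrite -subr_eq0 -evB// -cabs_eq0 eq_le cabs_ge0 andbT.
apply: disk_cont_closure => //; first exact: ev_cont.
by move=> w w1 wz _; rewrite evB// fg ?subrr ?cabs0// -zc.
Qed.

Lemma ev_eq_open f g : (forall z, cabs z < 1 -> ev f z = ev g z) -> f = g.
Proof.
move=> fg; apply: ev_inj => z z1; move: (z1); rewrite le_eqVlt.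
case/orP => [/eqP zc|/fg//].
apply/eqP; rewrite -subr_eq0 -evB// -cabs_eq0 eq_le cabs_ge0 andbT.
apply: disk_cont_closure => //; first exact: ev_cont.
by move=> w w1 _ /(_ zc) wlt; rewrite evB// fg ?subrr ?cabs0.
Qed.

Lemma disk_factor f c : cabs c < 1 -> ev f c = 0 ->
  exists h, f = (coord - c%:A) * h.
Proof.
move=> c1 fc; have hf := ev_holo f; have [_ df] := hf.
have dfc := df c c1 isT.
have [ch dh] := holo_diff_quot c1 dfc hf.
have hh : holo_off [::] (diff_quot (ev f) c).
  split; [exact: ch|move=> z z1 _]; have [->|zc] := eqVneq z c.
    exact: removable_singularity c1 (conj ch dh).
  have zn : z \notin [:: c] by rewrite inE.
  exact: dh z z1 zn.
have [h hE] := disk_fun_of hh; exists h.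
apply: (@ev_ext _ _ c) => z z1 zc.
rewrite evM// evB// ev_coord// evC// hE// /diff_quot (negPf zc) fc subr0.
by rewrite mulrC divfK// subr_eq0.
Qed.

(** Write f = 1 + z^n h by successive division.  For every N the function
(f^N - 1) / z^n is bounded by 2 and takes the value N h(0) at 0, hence
h(0) = 0 and the division goes on for ever; but h is bounded by 2 at each stage,
so that |f - 1| <= 2 |z|^n. *)
Lemma strong_maximum_one f : (forall z, cabs z <= 1 -> cabs (ev f z) <= 1) ->
  ev f 0 = 1 -> f = 1.
Proof.
move=> f1 f01.
have bound g h n : (forall z, cabs z <= 1 -> cabs (ev g z) <= 1) ->
    g - 1 = coord ^+ n * h -> forall z, cabs z <= 1 -> cabs (ev h z) <= 2.
  move=> g1 gh; apply: disk_max => z z1.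
  have z1' : cabs z <= 1 by rewrite z1.
  have := congr1 (fun x => cabs (ev x z)) gh.
  rewrite evB// evM// evX// ev_coord// ev1// cabsM cabsX z1 expr1n mul1r => <-.
  by have := cabsB (ev g z) 1; rewrite cabs1; have := g1 z z1'; lra.
have fact n : exists h, f - 1 = coord ^+ n * h.
  elim: n => [|n [h hE]]; first by exists (f - 1); rewrite expr0 mul1r.
  suff [h' hE'] : exists h', h = (coord - 0%:A) * h'.
    by exists h'; rewrite hE hE' scale0r subr0 exprSr mulrA.
  apply: disk_factor; first by rewrite cabs0.
  have key N : N%:R * cabs (ev h 0) <= 2.
    pose H := h * \sum_(i < N) f ^+ i.
    have HE : f ^+ N - 1 = coord ^+ n * H.
      by rewrite subrX1 hE /H mulrA.
    have fN z : cabs z <= 1 -> cabs (ev (f ^+ N) z) <= 1.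
      by move=> z1; rewrite evX// cabsX exprn_ile1 ?cabs_ge0 ?f1.
    have := bound _ _ _ fN HE 0 cabs_le1_0; have c0 := cabs_le1_0.
    rewrite evM// ev_sum// (eq_bigr (fun=> 1)); last first.
      by move=> i _; rewrite evX// f01 expr1n.
    by rewrite sumr_const card_ord cabsM cabs_nat mulrC.
  apply/eqP; rewrite -cabs_eq0; apply/eqP/le_anti; rewrite cabs_ge0 andbT.
  rewrite leNgt; apply/negP => h0.
  have := archi_boundP (divr_ge0 (ler0n R 2) (ltW h0)).
  by rewrite ltr_pdivrMr// ltNge key.
apply: ev_eq_open => z z1; have z1' := ltW z1.
apply/eqP; rewrite -subr_eq0 -evB// -cabs_eq0; apply/eqP/le_anti.
rewrite cabs_ge0 andbT; apply/ler_addgt0Pr => e e0; rewrite add0r.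
have [|n hn] := @pow_small R (cabs z) (e / 2) (cabs_ge0 _) z1 _.
  by rewrite divr_gt0.
have [h hE] := fact n; rewrite hE evM// evX// ev_coord// cabsM cabsX.
have := bound _ _ _ f1 hE z z1'; have := cabs_ge0 (ev h z).
have : 0 <= cabs z ^+ n by rewrite exprn_ge0 ?cabs_ge0.
move: hn; rewrite ltr_pdivlMr//; nra.
Qed.

(** A rotation reduces this to the previous lemma. *)
Lemma strong_maximum f : (forall z, cabs z <= 1 -> cabs (ev f z) <= 1) ->
  cabs (ev f 0) = 1 -> f = (ev f 0)%:A.
Proof.
move=> f1 f01; have n0 : ev f 0 != 0 by rewrite -cabs_eq0 f01 oner_eq0.
have : (ev f 0)^-1 *: f = 1.
  apply: strong_maximum_one => [z z1|]; last by rewrite evZ ?cabs0// mulVf.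
  by rewrite evZ// cabsM cabsV f01 invr1 mul1r f1.
by move=> <-; rewrite scalerA mulfV// scale1r.
Qed.

End DiskFunctions.

(** * Automorphisms of the disk algebra *)

Section Automorphisms.
Variable R : realType.
Local Notation C := (Cfield R).
Local Notation A := (disk_fun C).
Local Notation coord := (coord R).
Implicit Types (f g h u : A) (a b c k w z mu eta : C) (m : R) (s t : A -> A).

(** These two facts express that Moebius functions map the disk to itself and the
circle to itself; both come from
|1 - y^* x|^2 - |x - y|^2 = (1 - |x|^2) (1 - |y|^2). *)
Lemma cabs_sub_le (x y : C) : cabs x ^+ 2 <= 1 -> cabs y ^+ 2 <= 1 ->
  cabs (x - y) <= cabs (1 - y^*%C * x).
Proof.
move=> x1 y1; rewrite -(@ler_pXn2r _ 2)// ?nnegrE ?cabs_ge0//.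
have : 0 <= (1 - cabs x ^+ 2) * (1 - cabs y ^+ 2).
  by rewrite mulr_ge0// subr_ge0.
rewrite !cabs_sq; case: x y {x1 y1} => [a b] [a' b'] /=; rewrite !expr2; lra.
Qed.

Lemma cabs_sub_circle (x y : C) : cabs x = 1 ->
  cabs (x - y) = cabs (1 - y^*%C * x).
Proof.
move=> x1; apply/eqP; rewrite -(@eqrXn2 _ 2)// ?cabs_ge0//.
have : (1 - cabs x ^+ 2) * (1 - cabs y ^+ 2) = 0.
  by rewrite x1 expr1n subrr mul0r.
rewrite !cabs_sq; case: x y {x1} => [a b] [a' b'] /=; rewrite !expr2 => h.
by apply/eqP; lra.
Qed.

Lemma one_minus_neq0 (x y : C) : cabs x <= 1 -> cabs y < 1 -> 1 - y^*%C * x != 0.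
Proof.
move=> x1 y1; rewrite subr_eq0; apply: contraTneq y1 => h.
by rewrite -leNgt -(cabs1 R) h cabsM cabs_conj ler_piMr// cabs_ge0.
Qed.

(** Unital algebra endomorphisms, as a predicate on plain functions. *)
Definition alg_endo s := [/\ {morph s : f g / f + g},
  (forall k f, s (k *: f) = k *: s f), {morph s : f g / f * g} & s 1 = 1].

Section Endo.
Variables (s : A -> A) (sE : alg_endo s).

Lemma endoD f g : s (f + g) = s f + s g. Proof. by case: sE. Qed.
Lemma endoZ k f : s (k *: f) = k *: s f. Proof. by case: sE. Qed.
Lemma endoM f g : s (f * g) = s f * s g. Proof. by case: sE. Qed.
Lemma endo1 : s 1 = 1. Proof. by case: sE. Qed.
Lemma endoB f g : s (f - g) = s f - s g.
Proof. by rewrite endoD -scaleN1r endoZ scaleN1r. Qed.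
Lemma endoC k : s k%:A = k%:A.
Proof. by rewrite endoZ endo1. Qed.

(** The range of f on the disk is its spectrum, which an endomorphism can only
make smaller. *)
Lemma endo_le f m : (forall z, cabs z <= 1 -> cabs (ev f z) <= m) ->
  forall z, cabs z <= 1 -> cabs (ev (s f) z) <= m.
Proof.
move=> fm z z1; rewrite leNgt; apply/negP => mz.
pose l := ev (s f) z.
have [|g fg] := @disk_invertible R (f - l%:A).
  move=> w w1; rewrite evB// evC// subr_eq0; apply: contraTneq mz => fl.
  by rewrite -leNgt -/l -fl fm.
have := congr1 s fg; rewrite endoM endoB endoC endo1 => h.
by have := invertible_neq0 h z1; rewrite evB// evC// subrr eqxx.
Qed.

End Endo.

(** Let mu be the value at 0 of the image u of the coordinate z.  The image of the
Moebius function b = (z - mu) / (1 - mu^* z) vanishes at 0, hence is z h with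
|h| <= 1 (Schwarz).  Dividing the image of z under the inverse automorphism by b
shows that h is invertible with |1/h| <= 1, hence that h is a constant eta. *)
Lemma automorphism_moebius s t : alg_endo s -> alg_endo t ->
  cancel s t -> cancel t s ->
  exists mu eta, [/\ cabs mu < 1, cabs eta = 1 &
    s coord * (1 - (- (mu^*%C * eta)) *: coord) = mu%:A + eta *: coord].
Proof.
move=> sE tE st ts; pose u := s coord; pose mu := ev u 0.
have D0 := cabs_le1_0 R.
have coord_le z : cabs z <= 1 -> cabs (ev coord z) <= 1.
  by move=> z1; rewrite ev_coord.
have u1 := endo_le sE coord_le; rewrite -/u in u1.
have mu1 : cabs mu < 1.
  rewrite lt_neqAle u1// andbT; apply/eqP => mu1.
  have uE := strong_maximum u1 mu1.
  have : coord = mu%:A by rewrite -[LHS]st -/u uE (endoC tE).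
  move=> E; have := congr1 (fun x => ev x 0) E; rewrite ev_coord// evC// => m0.
  by move: mu1; rewrite -m0 cabs0 => /eqP; rewrite eq_sym oner_eq0.
pose den : A := 1 - mu^*%C *: coord.
have evden z : cabs z <= 1 -> ev den z = 1 - mu^*%C * z.
  by move=> z1; rewrite evB// ev1// evZ// ev_coord.
have [|di dK] := @disk_invertible R den.
  by move=> z z1; rewrite evden//; exact: one_minus_neq0.
pose b : A := (coord - mu%:A) * di.
have bden : b * den = coord - mu%:A by rewrite /b -mulrA (mulrC di) dK mulr1.
have evb z : cabs z <= 1 -> ev b z * (1 - mu^*%C * z) = z - mu.
  by move=> z1; rewrite -evden// -evM// bden evB// ev_coord// evC.
have b1 z : cabs z = 1 -> cabs (ev b z) = 1.
  move=> z1; have z1' : cabs z <= 1 by rewrite z1.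
  have n0 : cabs (1 - mu^*%C * z) != 0 by rewrite cabs_eq0 one_minus_neq0.
  apply: (mulIf n0); rewrite -cabsM evb// mul1r; exact: cabs_sub_circle.
have b1' : forall z, cabs z <= 1 -> cabs (ev b z) <= 1.
  by apply: disk_max => z /b1 ->.
pose v := s b.
have v1 := endo_le sE b1'; rewrite -/v in v1.
have vE : v * (1 - mu^*%C *: u) = u - mu%:A.
  have := congr1 s bden.
  by rewrite (endoM sE) (endoB sE) (endo1 sE) (endoZ sE) (endoB sE) (endoC sE).
have v0 : ev v 0 = 0.
  have := congr1 (fun x => ev x 0) vE.
  rewrite evM// !evB// ev1// evZ// evC// -/mu subrr => /eqP.
  rewrite mulf_eq0 => /orP[/eqP//|]; rewrite -[X in X == 0]/(1 - mu^*%C * mu).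
  by rewrite (negPf (one_minus_neq0 (ltW mu1) mu1)).
have [|h vh] := @disk_factor R v 0 _ v0; first by rewrite cabs0.
rewrite scale0r subr0 in vh.
have h1 : forall z, cabs z <= 1 -> cabs (ev h z) <= 1.
  apply: disk_max => z z1; have z1' : cabs z <= 1 by rewrite z1.
  by have := v1 z z1'; rewrite vh evM// ev_coord// cabsM z1 mul1r.
(* t coord - c vanishes at mu, hence is divisible by b. *)
pose c := ev (t coord) mu.
have [|k0 tk] := @disk_factor R (t coord - c%:A) mu mu1.
  by rewrite evB ?ltW// evC ?ltW// subrr.
have tbk : t coord - c%:A = b * (den * k0) by rewrite mulrA bden.
pose k := s (den * k0).
have zk : coord - c%:A = v * k.
  have := congr1 s tbk.
  by rewrite (endoM sE) (endoB sE) (endoC sE) ts.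
have c0 : c = 0.
  have := congr1 (fun x => ev x 0) zk.
  rewrite evB// ev_coord// evC// evM// v0 mul0r sub0r => /eqP.
  by rewrite oppr_eq0 => /eqP.
have hk : h * k = 1.
  apply: (@ev_ext R _ _ 0) => z z1 z0.
  have := congr1 (fun x => ev x z) zk.
  rewrite vh c0 scale0r subr0 -mulrA evM// ev_coord// ev1// => e.
  by apply: (mulfI z0); rewrite mulr1 -e.
have k1 : forall z, cabs z <= 1 -> cabs (ev k z) <= 1.
  apply: (endo_le sE); apply: disk_max => z z1.
  have z1' : cabs z <= 1 by rewrite z1.
  have := endo_le tE coord_le z1'.
  have -> : t coord = b * (den * k0) by rewrite -tbk c0 scale0r subr0.
  by rewrite evM// cabsM b1// mul1r.
have h01 : cabs (ev h 0) = 1.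
  have := congr1 (fun x => cabs (ev x 0)) hk; rewrite evM// ev1// cabsM cabs1 => e.
  by apply/eqP; rewrite eq_le h1//= -e ler_piMr ?cabs_ge0 ?k1.
have hE := strong_maximum h1 h01.
exists mu, (ev h 0); split => //.
set eta := ev h 0 in hE *.
have vE2 : v = eta *: coord by rewrite vh hE -scalerAr mulr1.
have uE : u = mu%:A + v * (1 - mu^*%C *: u) by rewrite vE addrC subrK.
rewrite -/u scaleNr opprK mulrDr mulr1 {1}uE vE2.
rewrite mulrBr mulr1 -!scalerAl -!scalerAr scalerA [coord * u]mulrC.
by rewrite [mu^*%C * eta]mulrC addrA subrK.
Qed.

(** Moebius functions preserve the unit circle. *)
Lemma automorphism_circle s t z : alg_endo s -> alg_endo t ->
  cancel s t -> cancel t s -> cabs z = 1 -> cabs (ev (s coord) z) = 1.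
Proof.
move=> sE tE st ts z1; have z1' : cabs z <= 1 by rewrite z1.
have [mu [eta [mu1 eta1 uE]]] := automorphism_moebius sE tE st ts.
have ez1 : cabs (eta * z) = 1 by rewrite cabsM eta1 z1 mulr1.
have n0 : 1 - (- mu)^*%C * (eta * z) != 0.
  by apply: one_minus_neq0; rewrite ?ez1 ?cabsN.
have := congr1 (fun x => cabs (ev x z)) uE.
rewrite evM// evB// ev1// evZ// ev_coord// evD// evC// evZ// ev_coord//.
have -> : 1 - - (mu^*%C * eta) * z = 1 - (- mu)^*%C * (eta * z).
  by rewrite rmorphN/=; ring.
rewrite cabsM -(cabs_sub_circle (- mu) ez1) opprK addrC => h.
have {}n0 : cabs (eta * z + mu) != 0.
  by rewrite -[mu]opprK (cabs_sub_circle (- mu) ez1) cabs_eq0.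
by apply: (mulIf n0); rewrite mul1r [eta * z + mu]addrC.
Qed.

End Automorphisms.

(** * Rational functions in the disk algebra *)

Section Rational.
Variable R : realType.
Local Notation C := (Cfield R).
Local Notation A := (disk_fun C).
Local Notation coord := (coord R).
Local Notation pol := (horner_alg coord).
Implicit Types (f g h u d : A) (a b c k w z : C) (e m : R) (s t : A -> A)
  (p q : {poly C}).

(** The rational functions without poles in the closed disk.  Their ring is a
principal ideal domain stable under the automorphisms, which the ring of
polynomials is not. *)
Definition rational : {pred A} := fun f =>
  `[< exists p q : {poly C}, (exists g, pol q * g = 1) /\ pol q * f = pol p >].

Lemma rational_subring : subring_closed rational.
Proof.
split.
- by apply/asboolP; exists 1, 1; rewrite rmorph1; split; [exists 1|]; rewrite mulr1.
- move=> f g /asboolP[p [q [[i qi] qf]]] /asboolP[p' [q' [[i' qi'] qf']]].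
  apply/asboolP; exists (q' * p - q * p'), (q * q'); split.
    by exists (i * i'); rewrite rmorphM/= mulrACA qi qi' mulr1.
  by rewrite rmorphB !rmorphM/= -qf -qf'; ring.
- move=> f g /asboolP[p [q [[i qi] qf]]] /asboolP[p' [q' [[i' qi'] qf']]].
  apply/asboolP; exists (p * p'), (q * q'); split.
    by exists (i * i'); rewrite rmorphM/= mulrACA qi qi' mulr1.
  by rewrite !rmorphM/= -qf -qf' mulrACA.
Qed.

HB.instance Definition _ := GRing.isSubringClosed.Build A rational rational_subring.

Lemma rational_pol p : pol p \in rational.
Proof.
apply/asboolP; exists p, 1; rewrite rmorph1; split; last by rewrite mul1r.
by exists 1; rewrite mulr1.
Qed.

Lemma rationalC k : k%:A \in rational.
Proof. by rewrite -(horner_algC coord); exact: rational_pol. Qed.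

Lemma rational_coord : coord \in rational.
Proof. by rewrite -[coord]horner_algX; exact: rational_pol. Qed.

Lemma rationalZ k f : f \in rational -> k *: f \in rational.
Proof. by move=> fP; rewrite -[f]mul1r scalerAl rpredM// rationalC. Qed.

Lemma rational_inv f g : f * g = 1 -> f \in rational -> g \in rational.
Proof.
move=> fg /asboolP[p [q [[i qi] qf]]]; apply/asboolP; exists q, p; split.
  by exists (i * g); rewrite -qf mulrACA qi fg mulr1.
by rewrite -qf -mulrA fg mulr1.
Qed.

(** It suffices to look at the image of the coordinate, because the inverses of
denominators are preserved. *)
Lemma rational_endo s f : alg_endo s -> s coord \in rational ->
  f \in rational -> s f \in rational.
Proof.
move=> sE sz.
have spol p : s (pol p) \in rational.
  elim/poly_ind: p => [|p c IH].
    by rewrite rmorph0 -[0](scale0r 1) (endoC sE) rationalC.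
  rewrite rmorphD rmorphM/= horner_algX horner_algC (endoD sE) (endoM sE).
  by rewrite (endoC sE) rpredD ?rationalC// rpredM.
move=> /asboolP[p [q [[i qi] qf]]].
have -> : f = i * pol p by rewrite -qf mulrA (mulrC i) qi mul1r.
rewrite (endoM sE) rpredM//; apply: (rational_inv _ (spol q)).
by rewrite -(endoM sE) qi (endo1 sE).
Qed.

Lemma rational_automorphism s t f : alg_endo s -> alg_endo t ->
  cancel s t -> cancel t s -> f \in rational -> s f \in rational.
Proof.
move=> sE tE st ts; apply: rational_endo => //.
have [mu [eta [mu1 eta1 uE]]] := automorphism_moebius sE tE st ts.
set k := - (_ * eta) in uE; pose d : A := 1 - k *: coord.
have dP : d \in rational by rewrite rpredB ?rpred1// rationalZ// rational_coord.
have nP : mu%:A + eta *: coord \in rational.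
  by rewrite rpredD ?rationalC// rationalZ// rational_coord.
have [|i di] := @disk_invertible R d.
  move=> z z1; rewrite evB// ev1// evZ// ev_coord//.
  have -> : k * z = (- mu)^*%C * (eta * z).
    by rewrite /k rmorphN/= !mulNr mulrA.
  by apply: one_minus_neq0; rewrite ?cabsN// cabsM eta1 mul1r.
have -> : s coord = (mu%:A + eta *: coord) * i.
  by rewrite -uE -mulrA di mulr1.
by rewrite rpredM//; exact: rational_inv di dP.
Qed.

(** Division by d leaves a finite-dimensional quotient of the ring of rational
functions.  A polynomial of least degree among those divisible by d is coprime
to every denominator, since their common factors are invertible; modulo d,
fractions are then polynomials, which can be reduced. *)
Lemma rational_quotient d : d \in rational -> d != 0 ->
  exists n, forall f, f \in rational -> exists p g,
    [/\ (size p <= n)%N, g \in rational & f = pol p + d * g].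
Proof.
move=> dP d0.
pose P n := `[< exists p g, [/\ p != 0, size p = n, g \in rational & pol p = d * g] >].
have exP : exists n, P n.
  have /asboolP[p [q [[i qi] qd]]] := dP.
  exists (size p); apply/asboolP; exists p, (pol q); split=> //.
  - apply: contra_neq d0 => p0; rewrite p0 rmorph0 in qd.
    by rewrite -[d]mul1r -qi mulrAC qd mul0r.
  - exact: rational_pol.
  - by rewrite -qd mulrC.
case: (ex_minnP exP) => n /asboolP[p1 [g1 [p10 sp1 g1P p1d]]] minn.
exists n => f /asboolP[p [q [[i qi] qf]]].
have iP : i \in rational by exact: rational_inv qi (rational_pol q).
have fP : f \in rational by apply/asboolP; exists p, q; split=> //; exists i.
have cop : coprimep q p1.
  have q0 : q != 0.
    apply/eqP => q0; move: qi; rewrite q0 rmorph0 mul0r => /eqP.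
    by rewrite eq_sym oner_eq0.
  pose e := gcdp q p1.
  have e_q : e %| q by exact: dvdp_gcdl.
  have e_p1 : e %| p1 by exact: dvdp_gcdr.
  have p1E : p1 = (p1 %/ e) * e by rewrite divpK.
  have qE : q = (q %/ e) * e by rewrite divpK.
  have e0 : e != 0 by rewrite gcdp_eq0 negb_and q0.
  have p2 : p1 %/ e != 0.
    by apply: contra_neq p10 => h; rewrite p1E h mul0r.
  (* e is invertible in the disk algebra, hence p1 / e is divisible by d too. *)
  have : P (size (p1 %/ e)).
    apply/asboolP; exists (p1 %/ e), (g1 * (i * pol (q %/ e))); split=> //.
      by rewrite !rpredM// rational_pol.
    rewrite mulrA -p1d {2}p1E rmorphM/=.
    rewrite -[LHS]mulr1 -[in LHS]qi {1}qE rmorphM/=; ring.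
  move=> /minn; rewrite -sp1 size_divp// => le1.
  have sp : (0 < size p1)%N by rewrite size_poly_gt0.
  have se : (0 < size e)%N by rewrite size_poly_gt0.
  rewrite /coprimep -/e; move: sp se le1; move: (size e) (size p1) => a b.
  by case: a => [|[|a]] // b0 _ /=; rewrite leqNgt ltn_subrL b0.
have /Bezout_eq1_coprimepP[[x y] xy] := cop.
exists ((x * p) %% p1), (g1 * (pol ((x * p) %/ p1) + pol y * f)); split.
- by rewrite -sp1 ltnW// ltn_modp.
- by rewrite rpredM// rpredD ?rational_pol// rpredM// rational_pol.
- rewrite mulrA -p1d mulrDr -!rmorphM/= addrA -rmorphD/=.
  rewrite [_ %% _ + _]addrC [p1 * _]mulrC -divp_eq.
  rewrite rmorphM/= -qf -[LHS]mul1r -(rmorph1 pol) -xy rmorphD !rmorphM/=; ring.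
Qed.

End Rational.

(** * Density of the rational functions *)

Section Density.
Variable R : realType.
Local Notation C := (Cfield R).
Local Notation D := (@closed_disk C).
Local Notation A := (disk_fun C).
Local Notation coord := (coord R).
Implicit Types (f g h u d : A) (a b c k w z : C) (e m r : R).

Let sqr_le1 z : cabs z <= 1 -> cabs z ^+ 2 <= 1.
Proof. by move=> z1; rewrite exprn_ile1 ?cabs_ge0. Qed.

(** Schur's algorithm.  If f maps the disk to itself and c = f 0 is not
unimodular, then (f - c) / (z (1 - c^* f)) again maps the disk to itself, by
Schwarz's lemma; an approximation of this function to order n at 0 yields one of
f to order n + 1. *)
Lemma schur_approximation n f : (forall z, cabs z <= 1 -> cabs (ev f z) <= 1) ->
  exists (r h : A), [/\ r \in @rational R,
    forall z, cabs z <= 1 -> cabs (ev r z) <= 1 & f - r = coord ^+ n * h].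
Proof.
elim: n f => [|n IH] f f1.
  exists 0, f; split; [exact: rpred0| |by rewrite subr0 expr0 mul1r].
  by move=> z z1; rewrite ev0// cabs0.
have D0 := cabs_le1_0 R; pose c := ev f 0.
have [c1|c1] := eqVneq (cabs c) 1.
  rewrite (strong_maximum f1 c1); exists c%:A, 0; split.
  - exact: rationalC.
  - by move=> z z1; rewrite evC// c1.
  - by rewrite subrr mulr0.
have {}c1 : cabs c < 1 by rewrite lt_neqAle c1 f1.
pose den : A := 1 - c^*%C *: f.
have evden z : cabs z <= 1 -> ev den z = 1 - c^*%C * ev f z.
  by move=> z1; rewrite evB// ev1// evZ.
have [|di dK] := @disk_invertible R den.
  by move=> z z1; rewrite evden//; exact: one_minus_neq0 (f1 z z1) c1.
(* g is f followed by the Moebius function that maps c to 0. *)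
pose g : A := (f - c%:A) * di.
have gden : g * den = f - c%:A by rewrite /g -mulrA (mulrC di) dK mulr1.
have g0 : ev g 0 = 0 by rewrite evM// evB// evC// subrr mul0r.
have g1 z : cabs z <= 1 -> cabs (ev g z) <= 1.
  move=> z1; have n0 : 1 - c^*%C * ev f z != 0 by exact: one_minus_neq0 (f1 z z1) c1.
  have := congr1 (fun x => cabs (ev x z)) gden.
  rewrite evM// evden// evB// evC// cabsM => e.
  have : cabs (ev f z - c) <= cabs (1 - c^*%C * ev f z).
    by apply: cabs_sub_le; apply: sqr_le1; [exact: f1|exact: ltW].
  by rewrite -e ger_pMl// cabs_gt0.
have [|f2 gE] := @disk_factor R g 0 _ g0; first by rewrite cabs0.
rewrite scale0r subr0 in gE.
have f21 : forall z, cabs z <= 1 -> cabs (ev f2 z) <= 1.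
  apply: disk_max => z z1; have z1' : cabs z <= 1 by rewrite z1.
  by have := g1 z z1'; rewrite gE evM// ev_coord// cabsM z1 mul1r.
have [r2 [h2 [r2P r21 fr2]]] := IH f2 f21.
have y1 z : cabs z <= 1 -> cabs (ev (coord * r2) z) <= 1.
  move=> z1; rewrite evM// ev_coord// cabsM; apply: mulr_ile1 => //;
    [exact: cabs_ge0|exact: cabs_ge0|exact: r21].
pose e : A := 1 + c^*%C *: (coord * r2).
have eve z : cabs z <= 1 -> ev e z = 1 - (- c)^*%C * ev (coord * r2) z.
  by move=> z1; rewrite evD// ev1// evZ// rmorphN/= mulNr opprK.
have nc1 : cabs (- c) < 1 by rewrite cabsN.
have e0 z : cabs z <= 1 -> ev e z != 0.
  by move=> z1; rewrite eve//; exact: one_minus_neq0 (y1 z z1) nc1.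
have [ei eK] := disk_invertible e0.
have yP : coord * r2 \in @rational R by rewrite rpredM// rational_coord.
have eP : e \in @rational R by rewrite rpredD ?rpred1// rationalZ.
(* r is coord * r2 followed by the inverse Moebius function. *)
pose r := (c%:A + coord * r2) * ei.
have rE : r * e = c%:A + coord * r2 by rewrite /r -mulrA (mulrC ei) eK mulr1.
exists r, (h2 * den * ei); split.
- by rewrite rpredM ?rpredD ?rationalC//; exact: rational_inv eK eP.
- move=> z z1; have := congr1 (fun x => cabs (ev x z)) rE.
  rewrite evM// (evD z1 c%:A) evC// cabsM => E.
  have : cabs (ev (coord * r2) z - (- c)) <= cabs (ev e z).
    rewrite eve//; apply: cabs_sub_le; apply: sqr_le1; first exact: y1.
    exact: ltW.
  by rewrite opprK [_ + c]addrC -E ger_pMl// cabs_gt0 e0.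
- have fE : f - c%:A = coord * f2 * den by rewrite -gden gE.
  have key : (f - r) * e = coord * (f2 - r2) * den.
    rewrite [coord * _]mulrBr [RHS]mulrBl -fE [LHS]mulrBl rE /e /den mulrDr mulrBr !mulr1.
    rewrite -!scalerAr [f * _]mulrC; set X := _ *: _; ring.
  have -> : f - r = (f - r) * e * ei by rewrite -mulrA eK mulr1.
  by rewrite key fr2 exprS !mulrA.
Qed.

Lemma holo_scale (F : C -> C) k : cabs k <= 1 -> holo_off [::] F ->
  holo_off [::] (fun z => F (k * z)).
Proof.
move=> k1 [cF dF]; have kz z : cabs (k * z) <= cabs z.
  by rewrite cabsM ler_piMl ?cabs_ge0.
split=> [z z1|z z1 _].
  apply/cvg_within_eps => e e0.
  have [d d0 hd] := disk_cont_eps cF (le_trans (kz z) z1) e0.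
  exists d => // w w1 wz; apply: hd; first exact: le_trans (kz w) w1.
  by rewrite -mulrBr; exact: le_lt_trans (kz _) wz.
apply: (@approx_derivable R _ _ ('D_1 F (k * z) * k)) => e e0.
have [d d0 hd] := derivable_approx (dF (k * z) (le_lt_trans (kz z) z1) isT) e0.
exists d => // w wz; rewrite -mulrA mulrBr.
have kwz : cabs (k * w - k * z) <= cabs (w - z) by rewrite -mulrBr.
apply: le_trans (hd _ (le_lt_trans kwz wz)) _.
by rewrite ler_wpM2l// ltW.
Qed.

Lemma dilation_exists k f : cabs k <= 1 ->
  exists g, forall z, cabs z <= 1 -> ev g z = ev f (k * z).
Proof. by move=> k1; apply: disk_fun_of; apply: holo_scale => //; exact: ev_holo. Qed.

Lemma dilation k : cabs k <= 1 -> exists s : A -> A, [/\ alg_endo s,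
  s coord = k *: coord &
  forall f z, cabs z <= 1 -> ev (s f) z = ev f (k * z)].
Proof.
move=> k1; exists (fun f => sval (cid (dilation_exists f k1))).
set s := (fun f => _); have sE f z : cabs z <= 1 -> ev (s f) z = ev f (k * z).
  exact: (svalP (cid (dilation_exists f k1))).
have kz z : cabs z <= 1 -> cabs (k * z) <= 1.
  by move=> z1; rewrite cabsM mulr_ile1 ?cabs_ge0.
split=> //; last by apply: ev_inj => z z1; rewrite sE// evZ// !ev_coord// kz.
split=> [f g|c f|f g|]; apply: ev_inj => z z1; have kz1 := kz z z1.
- by rewrite sE// !evD// !sE.
- by rewrite sE// !evZ// !sE.
- by rewrite sE// !evM// !sE.
- by rewrite sE// !ev1.
Qed.

Lemma nbhs_disc (z : C) (r : R) : 0 < r -> nbhs z [set w | cabs (w - z) < r].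
Proof.
move=> r0; apply/nbhs_ballP; exists (r%:C%C : C); first by rewrite /= ltcC.
by move=> w; rewrite -ball_normE /= cabsE ltcC (cabsC z).
Qed.

(** This is uniform continuity, by compactness of the disk. *)
Lemma dilation_close f e : 0 < e -> exists r, [/\ 0 <= r, r < 1 &
  forall z, cabs z <= 1 -> cabs (ev f (r%:C%C * z) - ev f z) <= e].
Proof.
move=> e0.
have cov := iffRL (near_covering_withinP D)
  (iffLR (compact_near_coveringP D) (@disk_compact R)).
have H : \forall r \near (1 : R)^'-,
    D `<=` (fun z => cabs (ev f (r%:C%C * z) - ev f z) <= e).
  apply: cov => x /in_disk x1.
  have [d d0 hd] := disk_cont_eps (@ev_cont R f) x1 (divr_gt0 e0 (ltr0n R 2)).
  have d2 : 0 < d / 2 by rewrite divr_gt0.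
  exists ([set w | cabs (w - x) < d / 2],
          [set r : R | [/\ 0 < r, 1 - d / 2 < r & r < 1]]).
    split => /=.
      exact: nbhs_disc.
    near=> r; split; near: r; [exact: nbhs_left_gt| |exact: nbhs_left_lt].
    by apply: nbhs_left_gt; rewrite gtrBl.
  move=> [w r] [/= wx [r0 rd r1]] /in_disk w1.
  have rw : cabs (r%:C%C * w) <= 1.
    by rewrite cabsM cabs_real ger0_norm ?(ltW r0)// mulr_ile1 ?cabs_ge0// ltW.
  have rww : cabs (r%:C%C * w - w) < d / 2.
    have -> : r%:C%C * w - w = - ((1 - r)%:C%C * w) by rewrite rmorphB/= rmorph1; ring.
    rewrite cabsN cabsM cabs_real ger0_norm; last by lra.
    apply: le_lt_trans (_ : 1 - r < d / 2); last by lra.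
    by rewrite ler_piMr// subr_ge0 ltW.
  have h1 := hd w w1 ltac:(lra).
  have h2 : cabs (ev f (r%:C%C * w) - ev f x) < e / 2.
    by apply: hd => //; have := cabs_tri w (r%:C%C * w) x; lra.
  move: h1 h2; move: (ev f x) (ev f w) (ev f (r%:C%C * w)) => X Y Z h1 h2.
  by have := cabs_tri X Z Y; rewrite (cabsC X); lra.
have [r [hr [r0 r1]]] := filter_ex (filterI H
  (filterI (nbhs_left_gt (@ltr01 R)) (nbhs_left_lt (1 : R)))).
by exists r; split; [exact: ltW|exact: r1|move=> z /in_disk; exact: hr].
Unshelve. all: by end_near.
Qed.

(** Schur's algorithm approximates f / M to order n at 0 with error at most
2 |z|^n, hence at most 2 r^n on the disk of radius r; replacing f z by f (r z)
turns this into a uniform approximation. *)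
Lemma rational_dense f e : 0 < e -> exists2 r : A, r \in @rational R &
  forall z, cabs z <= 1 -> cabs (ev f z - ev r z) <= e.
Proof.
move=> e0; have [m m0 fm] := disk_cont_bounded (@ev_cont R f).
pose M := m + 1; have M0 : 0 < M by rewrite ltr_wpDl.
pose K : C := M%:C%C; have K0 : K != 0 by rewrite -cabs_gt0 cabs_real normr_gt0 gt_eqF.
have cK : cabs K = M by rewrite cabs_real gtr0_norm.
have e2 : 0 < e / 2 by rewrite divr_gt0.
have [r [r0 r1 hr]] := dilation_close f e2.
have rc : cabs (r%:C%C : C) = r by rewrite cabs_real ger0_norm.
have [|s [sE sz evs]] := @dilation (r%:C%C); first by rewrite rc ltW.
have [|n hn] := @pow_small R r (e / (4 * M)) r0 r1.
  by rewrite divr_gt0// mulr_gt0.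
have [|p [h [pP p1 fp]]] := @schur_approximation n (K^-1 *: f).
  move=> z z1; rewrite evZ// cabsM cabsV cK mulrC ler_pdivrMr// mul1r.
  by have := fm z z1; rewrite /M; lra.
have h2 : forall z, cabs z <= 1 -> cabs (ev h z) <= 2.
  apply: disk_max => z z1; have z1' : cabs z <= 1 by rewrite z1.
  have := congr1 (fun x => cabs (ev x z)) fp.
  rewrite evB// evM// evX// ev_coord// cabsM cabsX z1 expr1n mul1r => <-.
  have := cabsB (ev (K^-1 *: f) z) (ev p z); have := p1 z z1'.
  have : cabs (ev (K^-1 *: f) z) <= 1.
    rewrite evZ// cabsM cabsV cK mulrC ler_pdivrMr// mul1r.
    by have := fm z z1'; rewrite /M; lra.
  lra.
exists (K *: s p).
  rewrite rationalZ//; apply: rational_endo => //.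
  by rewrite sz rationalZ// rational_coord.
move=> z z1; have rz : cabs (r%:C%C * z) <= 1.
  by rewrite cabsM rc mulr_ile1 ?cabs_ge0// ltW.
rewrite evZ// evs//; have := congr1 (fun x => ev x (r%:C%C * z)) fp.
rewrite evB// evM// evX// ev_coord// evZ// => E.
have -> : ev f z - K * ev p (r%:C%C * z) =
    - (ev f (r%:C%C * z) - ev f z) + K * ((r%:C%C * z) ^+ n * ev h (r%:C%C * z)).
  by rewrite -E; field.
apply: le_trans (cabsD _ _) _; rewrite cabsN [leRHS]splitr; apply: lerD.
  exact: hr.
rewrite !cabsM cK cabsX cabsM rc exprMn.
have zn : 0 <= cabs z ^+ n <= 1 by rewrite exprn_ge0 ?cabs_ge0// exprn_ile1 ?cabs_ge0.
have hh := h2 _ rz; have hp := cabs_ge0 (ev h (r%:C%C * z)).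
move: hn; rewrite ltr_pdivlMr ?mulr_gt0// => hn.
have rn : 0 <= r ^+ n by rewrite exprn_ge0.
have : r ^+ n * cabs z ^+ n * cabs (ev h (r%:C%C * z)) <= r ^+ n * 2.
  rewrite -mulrA ler_wpM2l//; case/andP: zn => zn0 zn1.
  by apply: le_trans hh; rewrite ler_piMl.
by move=> /(ler_wpM2l (ltW M0)); lra.
Qed.

End Density.

(** * Linear algebra over a left ideal *)

(** Modulo the left ideal generated by a, the span of the e k is a
finite-dimensional module which right multiplication by b maps to itself, and
b + t maps it onto itself unless - t is an eigenvalue. *)
Lemma generic_left_generation (F : fieldType) (L : algType F) (a b : L) (n : nat)
    (e : 'I_n -> L) :
  (forall j, exists (c : 'I_n -> F) (y : L),
     e j * b = \sum_k c k *: e k + y * a) ->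
  (exists (c : 'I_n -> F) (y : L), 1 = \sum_k c k *: e k + y * a) ->
  exists2 p : {poly F}, p != 0 & forall t, ~~ root p t ->
    exists x y, x * a + y * (b + t%:A) = 1.
Proof.
move=> eb [c0 [y0 one]].
pose c j := sval (cid (eb j)); pose y j := sval (cid (svalP (cid (eb j)))).
have ebE j : e j * b = \sum_k c j k *: e k + y j * a.
  exact: (svalP (cid (svalP (cid (eb j))))).
pose M : 'M[F]_n := \matrix_(j, k) c j k.
exists (char_poly (- M)); first exact: monic_neq0 (char_poly_monic _).
move=> t; rewrite /root -horner_evalE -det_map_mx => dt.
pose T : 'M[F]_n := M + t%:M.
have TU : T \in unitmx.
  rewrite unitmxE unitfE; apply: contraNneq dt => dT.
  apply/eqP; rewrite -[RHS]dT; congr (\det _); apply/matrixP => i j.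
  rewrite !mxE /= horner_evalE hornerD hornerN hornerMn hornerX !hornerE.
  by rewrite opprK addrC.
have ebT j : e j * (b + t%:A) = \sum_k T j k *: e k + y j * a.
  rewrite mulrDr ebE -scalerAr mulr1 addrAC; congr (_ + _).
  rewrite -[X in _ + X](_ : \sum_k (t%:M : 'M[F]_n) j k *: e k = t *: e j); last first.
    rewrite (bigD1 j)//= big1 ?addr0 => [|k kj]; first by rewrite mxE eqxx mulr1n.
    by rewrite mxE eq_sym (negPf kj) mulr0n scale0r.
  by rewrite -big_split /=; apply: eq_bigr => k _; rewrite -scalerDl !mxE.
pose w : 'rV[F]_n := (\row_k c0 k) *m invmx T.
have wT k : \sum_j w 0 j * T j k = c0 k.
  have : (w *m T) 0 k = c0 k by rewrite /w mulmxKV// mxE.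
  by rewrite mxE.
exists (y0 - \sum_j w 0 j *: y j), (\sum_j w 0 j *: e j).
rewrite [RHS]one mulrBl !mulr_suml.
have -> : \sum_j w 0 j *: e j * (b + t%:A) =
    \sum_k c0 k *: e k + \sum_j w 0 j *: y j * a.
  transitivity (\sum_j \sum_k (w 0 j * T j k) *: e k + \sum_j w 0 j *: y j * a).
    rewrite -big_split; apply: eq_bigr => j _ /=.
    rewrite -scalerAl ebT scalerDr scaler_sumr -scalerAl; congr (_ + _).
    by apply: eq_bigr => k _; rewrite scalerA.
  rewrite exchange_big; congr (_ + _); apply: eq_bigr => k _ /=.
  by rewrite -scaler_suml wT.
by rewrite addrCA subrK addrC.
Qed.

Section Perturbation.
Variable R : realType.
Local Notation C := (Cfield R).

Lemma small_nonroot (p : {poly C}) (e : R) : p != 0 -> 0 < e ->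
  exists2 t : C, cabs t <= e & ~~ root p t.
Proof.
move=> p0 e0; apply: contrapT => /forall2NP h.
pose u (k : nat) : C := (e / k.+1%:R)%:C%C.
pose s := [seq u k | k <- iota 0 (size p)].
have us : uniq s.
  rewrite map_inj_uniq ?iota_uniq// => i j /complexI.
  have en : e != 0 by rewrite gt_eqF.
  by move=> /(mulfI en)/invr_inj/eqP; rewrite eqr_nat => /eqP[].
have rs : all (root p) s.
  apply/allP => _ /mapP[k _ ->]; have [|/negP] := h (u k); last by rewrite negbK.
  move=> /negP; rewrite cabs_real ger0_norm ?divr_ge0 ?(ltW e0)//.
  by rewrite ler_pdivrMr// ler_peMr ?(ltW e0)// ler1n.
by have := max_poly_roots p0 rs us; rewrite size_map size_iota ltnn.
Qed.

(** Only finitely many scalars t are opposites of eigenvalues of M. *)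
Lemma small_det_neq0 n (M : 'M[C]_n) (e : R) : 0 < e ->
  exists2 t : C, cabs t <= e & \det (M + t%:M) != 0.
Proof.
move=> e0.
have [t te tr] := small_nonroot (monic_neq0 (char_poly_monic (- M))) e0.
exists t => //; apply: contraNneq tr => dT.
rewrite /root -horner_evalE -det_map_mx; apply/eqP; rewrite -[RHS]dT.
congr (\det _); apply/matrixP => i j.
rewrite !mxE /= horner_evalE hornerD hornerN hornerMn hornerX !hornerE.
by rewrite opprK addrC.
Qed.

End Perturbation.

(** * The crossed product *)

Section CrossedProduct.
Variables (R : realType) (K : finGroupType).
Variable alpha : banach_action (disk_algebra R) K.
Local Notation C := (Cfield R).
Local Notation A := (disk_fun C).
Local Notation coord := (coord R).
Local Notation L := (l1_fun alpha).
Implicit Types (f x y : L) (g h : K) (z : C).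

(** The action and the values of the elements of l^1(K, A) are those of the normed
algebra A, whose type remembers no commutativity; act and coef bring them back to
the commutative ring of disk functions. *)
Definition act g (u : A) : A := alpha g u.

Lemma act_endo g : alg_endo (act g).
Proof.
split; first exact: (linearD (alpha g)).
- exact: (linearZ_LR (alpha g)).
- exact: (rmorphM (alpha g)).
- exact: (rmorph1 (alpha g)).
Qed.

Lemma act_id u : act 1%g u = u.
Proof. by rewrite /act banach_act1. Qed.

Lemma actM g h u : act (g * h)%g u = act g (act h u).
Proof. by rewrite /act banach_actM. Qed.

Lemma actK g : cancel (act g) (act g^-1%g).
Proof. by move=> u; rewrite -actM mulVg act_id. Qed.

Lemma actVK g : cancel (act g^-1%g) (act g).
Proof. by move=> u; rewrite -actM mulgV act_id. Qed.

Lemma act_circle g z : cabs z = 1 -> cabs (ev (act g coord) z) = 1.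
Proof.
exact: automorphism_circle (act_endo g) (act_endo g^-1%g) (@actK g) (@actVK g).
Qed.

Lemma act_rational g u : u \in @rational R -> act g u \in @rational R.
Proof.
exact: rational_automorphism (act_endo g) (act_endo g^-1%g) (@actK g) (@actVK g).
Qed.

Definition coef f g : A := f g.

Lemma coefM x y g : coef (x * y) g = \sum_h coef x h * act h (coef y (h^-1 * g)%g).
Proof. exact: ffunE. Qed.

Lemma coefD x y g : coef (x + y) g = coef x g + coef y g.
Proof. exact: ffunE. Qed.

Lemma coefN x g : coef (- x) g = - coef x g.
Proof. exact: ffunE. Qed.

Lemma coefZ (k : C) x g : coef (k *: x) g = k *: coef x g.
Proof. exact: ffunE. Qed.

Lemma coef1 g : coef 1 g = (g == 1%g)%:R.
Proof. exact: ffunE. Qed.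

Lemma coef_inj x y : (forall g, coef x g = coef y g) -> x = y.
Proof. by move=> h; apply/ffunP. Qed.

Lemma coef_of (F : K -> A) : exists x : L, forall g, coef x g = F g.
Proof. by exists [ffun g => F g]; move=> g; exact: ffunE. Qed.

End CrossedProduct.

(** * Left ideals of the crossed product *)

Section Bounds.
Variables (R : realType) (K : finGroupType).
Variable alpha : banach_action (disk_algebra R) K.
Local Notation C := (Cfield R).
Local Notation A := (disk_fun C).
Local Notation coord := (coord R).
Local Notation L := (l1_fun alpha).
Local Notation pol := (horner_alg coord).
Local Notation act := (act alpha).
Implicit Types (f x y : L) (g h : K) (z : C) (e : R).

(** Suppose x * f = 1 with f close to coord at the identity.  On the circle the
functions act g coord are unimodular, so the equation bounds the values of x;
the maximum principle extends the bound to the disk, where it contradicts the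
equation at 0, since coord vanishes there. *)
Lemma coord_not_left_invertible x f (e : K -> R) :
  (forall g z, cabs z <= 1 ->
     cabs (ev (coef f g - (g == 1%g)%:R * coord) z) <= e g) ->
  \sum_g e g <= 1 / 4 -> x * f <> 1.
Proof.
move=> fe e4 xf.
pose E g : A := coef f g - (g == 1%g)%:R * coord.
have eq1 g : coef x g * act g coord + \sum_h coef x h * act h (E (h^-1 * g)%g) =
    (g == 1%g)%:R.
  rewrite -(coef1 alpha) -xf coefM.
  have -> : coef x g * act g coord =
      \sum_h coef x h * act h (((h^-1 * g)%g == 1%g)%:R * coord).
    rewrite (bigD1 g)//= mulVg eqxx mul1r big1 ?addr0// => h hg.
    rewrite -eq_mulVg1 (negPf hg) mul0r -(scale0r 1) (endoC (act_endo _ _)).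
    by rewrite scale0r mulr0.
  rewrite -big_split; apply: eq_bigr => h _ /=.
  by rewrite -mulrDr -(endoD (act_endo _ _)) addrC subrK.
have Ee g h z : cabs z <= 1 -> cabs (ev (act h (E g)) z) <= e g.
  by move=> z1; apply: (endo_le (act_endo alpha h)) z1 => w w1; exact: fe.
have sum_bound g z : cabs z <= 1 ->
    cabs (ev (\sum_h coef x h * act h (E (h^-1 * g)%g)) z) <=
    \sum_h cabs (ev (coef x h) z) * e (h^-1 * g)%g.
  move=> z1; rewrite ev_sum//; elim/big_rec2: _ => [|h u v _ IH].
    by rewrite cabs0.
  apply: le_trans (cabsD _ _) _; apply: lerD => //.
  by rewrite evM// cabsM ler_wpM2l ?cabs_ge0// Ee.
have e0 g : 0 <= e g.
  exact: le_trans (cabs_ge0 _) (fe g 0 (cabs_le1_0 R)).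
have shift h : \sum_g e (h^-1 * g)%g = \sum_g e g.
  by rewrite [RHS](reindex_inj (mulgI h^-1%g)).
have circle g z : cabs z = 1 -> cabs (ev (coef x g) z) <= 2.
  move=> z1; have z1' : cabs z <= 1 by rewrite z1.
  pose S := \sum_h cabs (ev (coef x h) z).
  have S1 : S <= 1 + S / 4.
    have le g' : cabs (ev (coef x g') z) <=
        (g' == 1%g)%:R + \sum_h cabs (ev (coef x h) z) * e (h^-1 * g')%g.
      have := congr1 (fun u => ev u z) (eq1 g'); rewrite evD// => E1.
      have -> : cabs (ev (coef x g') z) = cabs (ev (coef x g' * act g' coord) z).
        by rewrite evM// cabsM act_circle// mulr1.
      have -> : ev (coef x g' * act g' coord) z = ev (g' == 1%g)%:R z -
          ev (\sum_h coef x h * act h (E (h^-1 * g')%g)) z by rewrite -E1 addrK.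
      apply: le_trans (cabsB _ _) _; apply: lerD; last exact: sum_bound.
      by case: (g' == 1%g); rewrite ?ev1 ?ev0 ?cabs1 ?cabs0.
    have : S <= \sum_g' ((g' == 1%g)%:R +
        \sum_h cabs (ev (coef x h) z) * e (h^-1 * g')%g) by exact: ler_sum.
    rewrite big_split /= (bigD1 1%g)//= eqxx big1 ?addr0 => [|g' /negPf ->//].
    rewrite exchange_big /=.
    under eq_bigr => h _ do rewrite -mulr_sumr shift.
    rewrite -mulr_suml -/S => h; apply: le_trans h _; rewrite lerD2l.
    rewrite ler_wpM2l//; last by lra.
    by apply: sumr_ge0 => h _; exact: cabs_ge0.
  have : cabs (ev (coef x g) z) <= S.
    rewrite /S (bigD1 g)//= lerDl; apply: sumr_ge0 => h _; exact: cabs_ge0.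
  by lra.
have disk g : cabs (ev (coef x g) 0) <= 2.
  by apply: disk_max (cabs_le1_0 R) => z; exact: circle.
have D0 := cabs_le1_0 R.
have := congr1 (fun u => cabs (ev u 0)) (eq1 1%g).
have -> : act 1%g coord = coord by exact: act_id.
rewrite eqxx evD// evM// ev_coord// mulr0 add0r ev1// cabs1 => E1.
have := sum_bound 1%g 0 D0; rewrite E1 => le1.
have : \sum_h cabs (ev (coef x h) 0) * e (h^-1 * 1)%g <= \sum_h 2 * e (h^-1 * 1)%g.
  by apply: ler_sum => h _; rewrite ler_wpM2r.
rewrite -mulr_sumr.
have -> : \sum_h e (h^-1 * 1)%g = \sum_g e g.
  by rewrite [RHS](reindex_inj invg_inj); apply: eq_bigr => h _; rewrite mulg1.
by lra.
Qed.

Definition rational_coefs f := forall g, coef f g \in @rational R.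

Lemma rational_coefsM x y : rational_coefs x -> rational_coefs y ->
  rational_coefs (x * y).
Proof.
move=> xP yP g; rewrite coefM; apply: rpred_sum => h _.
by rewrite rpredM ?xP// act_rational// yP.
Qed.

Let elt (i : 'I_#|K|) : K := enum_val i.

(** The matrix of right multiplication by a on the free left module l^1(K, A). *)
Definition rmul_mx (a : L) : 'M[A]_#|K| :=
  \matrix_(i, j) act (elt i) (coef a ((elt i)^-1 * elt j)%g).

Lemma coefM_row x a j :
  coef (x * a) (elt j) = ((\row_i coef x (elt i)) *m rmul_mx a) 0 j.
Proof.
rewrite coefM mxE (reindex elt) /=; last exact: onW_bij (enum_val_bij _).
by apply: eq_bigr => i _; rewrite !mxE.
Qed.

Lemma rmul_mxDC a (t : C) : rmul_mx (a + t%:A) = rmul_mx a + (t%:A)%:M.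
Proof.
apply/matrixP => i j; rewrite !mxE coefD coefZ coef1 (endoD (act_endo _ _)).
congr (_ + _); rewrite -eq_mulVg1 (inj_eq enum_val_inj).
case: eqP => _; first by rewrite (endoC (act_endo _ _)) mulr1n.
by rewrite scaler0 -(scale0r 1) (endoC (act_endo _ _)) scale0r.
Qed.

Lemma rational_det n (M : 'M[A]_n) : (forall i j, M i j \in @rational R) ->
  \det M \in @rational R.
Proof.
move=> MP; apply: rpred_sum => s _; rewrite rpredM ?rpred_prod//.
by rewrite rpredX// rpredN rpred1.
Qed.

(** Cramer's rule: the left ideal of a contains the determinant times everything. *)
Lemma det_left_ideal (a : L) (c : K -> A) :
  exists y, forall g, coef (y * a) g = \det (rmul_mx a) * c g.
Proof.
pose v : 'rV[A]_#|K| := (\row_i c (elt i)) *m \adj (rmul_mx a).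
have [y yE] := coef_of alpha (fun g => v 0 (enum_rank g)).
exists y => g; rewrite -[g](enum_rankK g) -/(elt _) coefM_row.
have -> : \row_i coef y (elt i) = v.
  by apply/rowP => i; rewrite mxE yE /elt enum_valK.
by rewrite -mulmxA mul_adj_mx mul_mx_scalar !mxE.
Qed.

Lemma pol_wide n (p : {poly C}) : (size p <= n)%N ->
  pol p = \sum_(i < n) p`_i *: coord ^+ i.
Proof.
move=> pn; have {1}-> : p = \sum_(i < n) p`_i *: 'X^i.
  rewrite -poly_def; apply/polyP => i; rewrite coef_poly; case: ltnP => // ni.
  by rewrite nth_default// (leq_trans pn).
rewrite linear_sum; apply: eq_bigr => i _.
by rewrite linearZ /= rmorphXn/= horner_algX -scalerAl mul1r.
Qed.

(** Each rational coefficient is a polynomial of bounded degree plus a multiple of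
the determinant of right multiplication by a, and the multiples of this
determinant lie in the left ideal of a. *)
Lemma rational_span (a : L) : rational_coefs a -> \det (rmul_mx a) != 0 ->
  exists n (E : 'I_n -> L), (forall j, rational_coefs (E j)) /\
    forall x, rational_coefs x -> exists (c : 'I_n -> C) (y : L),
      x = \sum_k c k *: E k + y * a.
Proof.
move=> aP d0; have dP : \det (rmul_mx a) \in @rational R.
  by apply: rational_det => i j; rewrite mxE act_rational.
have [n hn] := rational_quotient dP d0.
pose F (u : K * 'I_n) : L := sval (cid (coef_of alpha
  (fun h => (h == u.1)%:R * coord ^+ u.2))).
have FE u h : coef (F u) h = (h == u.1)%:R * coord ^+ u.2.
  exact: (svalP (cid (coef_of alpha (fun h => (h == u.1)%:R * coord ^+ u.2)))).
exists #|{: K * 'I_n}|, (fun k => F (enum_val k)); split=> [k h|x xP].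
  by rewrite FE rpredM ?rpred_nat// rpredX// rational_coord.
have hx g : exists pc : {poly C} * A, [/\ (size pc.1 <= n)%N &
    coef x g = pol pc.1 + \det (rmul_mx a) * pc.2].
  by have [p [c [pn _ E]]] := hn _ (xP g); exists (p, c).
pose pc g := sval (cid (hx g)).
have pn g : (size (pc g).1 <= n)%N by case: (svalP (cid (hx g))).
have pE g : coef x g = pol (pc g).1 + \det (rmul_mx a) * (pc g).2.
  by case: (svalP (cid (hx g))).
have [y yE] := det_left_ideal a (fun g => (pc g).2).
exists (fun k : 'I_#|{: K * 'I_n}| =>
  (pc (enum_val k).1).1`_((enum_val k).2 : 'I_n)), y.
apply: coef_inj => g; rewrite coefD yE pE; congr (_ + _).
rewrite (pol_wide (pn g)).
have coef_sum (I : finType) (G : I -> L) :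
    coef (\sum_i G i) g = \sum_i coef (G i) g.
  elim/big_rec2: _ => [|i u v _ <-]; last by rewrite coefD.
  by rewrite -(subrr (0 : L)) coefD coefN subrr.
rewrite coef_sum.
transitivity (\sum_(u : K * 'I_n) ((pc u.1).1`_u.2 *: coef (F u) g)); last first.
  rewrite (reindex (fun k : 'I_#|{: K * 'I_n}| => enum_val k)) /=; last first.
    exact: onW_bij (enum_val_bij _).
  by apply: eq_bigr => k _; rewrite coefZ.
rewrite -(pair_bigA _ (fun h i => (pc h).1`_(i : 'I_n) *: coef (F (h, i)) g)) /=.
rewrite (bigD1 g)//= [X in _ + X]big1 ?addr0 => [|h hg].
  by apply: eq_bigr => i _; rewrite FE eqxx mul1r.
by apply: big1 => i _; rewrite FE eq_sym (negPf hg) mul0r scaler0.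
Qed.

End Bounds.

(** * Stable rank *)

Section StableRank.
Variables (R : realType) (K : finGroupType).
Variable alpha : banach_action (disk_algebra R) K.
Local Notation C := (Cfield R).
Local Notation A := (disk_fun C).
Local Notation coord := (coord R).
Local Notation L := (l1_fun alpha).
Local Notation B := (l1_alg alpha).
Implicit Types (a b f x y : L) (g h : K) (z : C) (e : R).

Definition ev_center (u : A) : C := ev u 0.

Lemma ev_center_zmod : zmod_morphism ev_center.
Proof. by move=> u v; exact: evB (cabs_le1_0 R) u v. Qed.

Lemma ev_center_monoid : monoid_morphism ev_center.
Proof.
split; first exact: ev1 (cabs_le1_0 R).
by move=> u v; exact: evM (cabs_le1_0 R) u v.
Qed.

HB.instance Definition _ := GRing.isZmodMorphism.Build A C ev_center ev_center_zmod.
HB.instance Definition _ :=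
  GRing.isMonoidMorphism.Build A C ev_center ev_center_monoid.

Lemma coef_scalar_le (t : C) g z : cabs z <= 1 ->
  cabs (ev (coef (t%:A : L) g) z) <= cabs t.
Proof.
move=> z1; rewrite coefZ coef1; case: eqP => _.
  by rewrite evZ// ev1// mulr1.
by rewrite evZ// ev0// mulr0 cabs0 cabs_ge0.
Qed.

Lemma rational_coefs_dense a e : 0 < e -> exists2 a' : L, rational_coefs a' &
  forall g z, cabs z <= 1 -> cabs (ev (coef a' g - coef a g) z) <= e.
Proof.
move=> e0.
pose F g : A := s2val (cid2 (rational_dense (coef a g) e0)).
have [a' a'E] := coef_of alpha F; exists a' => g.
  by rewrite a'E; exact: (s2valP (cid2 (rational_dense (coef a g) e0))).
move=> z z1; rewrite a'E evB// cabsC.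
exact: (s2valP' (cid2 (rational_dense (coef a g) e0))).
Qed.

(** First a is made rational and perturbed by a scalar, so that the determinant of
right multiplication by a does not vanish at 0; then the left ideal of a has a
finite-dimensional quotient on rational elements, and adding a small scalar to a
rational approximation of b gives a generator of this quotient. *)
Lemma generating_pair_dense a b e : 0 < e -> exists a' b', [/\
  forall g z, cabs z <= 1 -> cabs (ev (coef a' g - coef a g) z) <= e,
  forall g z, cabs z <= 1 -> cabs (ev (coef b' g - coef b g) z) <= e &
  exists x y, x * a' + y * b' = 1].
Proof.
move=> e0; have e2 : 0 < e / 2 by rewrite divr_gt0.
have [a1 a1P aa1] := rational_coefs_dense a e2.
have [b1 b1P bb1] := rational_coefs_dense b e2.
have close (c c1 : L) (t : C) : cabs t <= e / 2 ->
    (forall g z, cabs z <= 1 -> cabs (ev (coef c1 g - coef c g) z) <= e / 2) ->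
    forall g z, cabs z <= 1 ->
    cabs (ev (coef (c1 + t%:A) g - coef c g) z) <= e.
  move=> te cc1 g z z1.
  rewrite coefD addrAC evD//; apply: le_trans (cabsD _ _) _.
  rewrite [leRHS]splitr; apply: lerD; first exact: cc1.
  by apply: le_trans te; exact: coef_scalar_le.
have [t te dt] := small_det_neq0 (map_mx ev_center (rmul_mx a1)) e2.
pose a2 : L := a1 + t%:A.
have a2P : rational_coefs a2.
  move=> g; rewrite coefD rpredD// coefZ coef1 rationalZ// rpred_nat//.
have d2 : \det (rmul_mx a2) != 0.
  apply: contraNneq dt => d0; apply/eqP.
  have <- : ev_center (\det (rmul_mx a2)) = 0 by rewrite d0 raddf0.
  rewrite -det_map_mx rmul_mxDC map_mxD map_scalar_mx /=.
  by rewrite /ev_center evC// cabs_le1_0.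
have [n [E [EP span]]] := rational_span a2P d2.
have [||p p0 hp] := @generic_left_generation C L a2 b1 n E.
- by move=> j; apply: span; exact: rational_coefsM.
- by apply: span => g; rewrite coef1 rpred_nat.
have [t' te' pt'] := small_nonroot p0 e2.
exists a2, (b1 + t'%:A); split; [exact: close|exact: close|exact: hp].
Qed.

Lemma ev_le_norm (u : A) z : cabs z <= 1 -> cabs (ev u z) <= complex.Re (disk_norm u).
Proof.
move=> z1; have Dz := iffRL (in_disk z) z1.
have := cabs_le u (SigSub (mem_set Dz)); rewrite -ev_val /=.
rewrite cabsE -[X in _ <= X]RRe_real ?lecC//.
by rewrite ger0_real// disk_norm_ge0.
Qed.

Lemma norm_le_ev (u : A) e : (forall z, cabs z <= 1 -> cabs (ev u z) <= e) ->
  disk_norm u <= e%:C%C.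
Proof.
move=> h; apply: disk_norm_le => z; rewrite -ev_val cabsE lecC; apply: h.
by apply/in_disk; exact: set_mem (valP z).
Qed.

Lemma l1_norm_le x e : (forall g z, cabs z <= 1 -> cabs (ev (coef x g) z) <= e) ->
  l1_norm x <= (#|K|%:R * e)%:C%C.
Proof.
move=> h; have -> : (#|K|%:R * e)%:C%C = \sum_(g : K) (e%:C%C : C).
  by rewrite sumr_const mulr_natl rmorphMn.
by apply: ler_sum => g _; apply: norm_le_ev; exact: h.
Qed.

Lemma not_dense_Lg1 : ~ dense (@Lg R B 1).
Proof.
move=> dB.
have [f fE] := coef_of alpha (fun g => (g == 1%g)%:R * coord).
pose F : 'rV[B]_1 := const_mx (f : B).
pose r : C := (1 / 8)%:C%C.
have r0 : 0 < r by rewrite ltcC.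
have [||a [/interior_subset Fa La]] := dB (interior (ball F r)).
- by exists F; exact: nbhsx_ballx.
- exact: open_interior.
have [_ /(_ 0 0)] := Fa; rewrite mxE -ball_normE /= => fa.
have [b] := La 1; rewrite big_ord1 => one.
pose a0 : L := a 0 0; pose b0 : L := b 0 0.
have {}one : b0 * a0 = 1 by exact: esym one.
pose D : L := f - a0.
have nD : l1_norm D < r by exact: fa.
pose e g : R := complex.Re (disk_norm (coef D g)).
have eE g : disk_norm (coef D g) = (e g)%:C%C.
  by rewrite RRe_real// ger0_real// disk_norm_ge0.
apply: (@coord_not_left_invertible R K alpha b0 a0 e _ _ one).
  move=> g z z1; rewrite -fE evB// cabsC -evB//.
  have -> : coef f g - coef a0 g = coef D g by rewrite coefD coefN.
  exact: ev_le_norm.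
have : (\sum_g e g)%:C%C < r :> C.
  rewrite rmorph_sum; apply: le_lt_trans nD; rewrite le_eqVlt; apply/orP; left.
  by apply/eqP; apply: eq_bigr => g _; exact: esym (eE g).
by rewrite ltcC; lra.
Qed.

Lemma dense_Lg2 : dense (@Lg R B 2).
Proof.
move=> O [c Oc] oO.
have /nbhs_ballP[r /= r0 rO] : nbhs c O by exact: open_nbhs_nbhs.
have rE : r = (complex.Re r)%:C%C by rewrite RRe_real// gtr0_real.
have r1 : 0 < complex.Re r by rewrite -ltcC -rE.
have K1 : 0 < #|K|%:R + 1 :> R by rewrite ltr_wpDl.
pose e := complex.Re r / (#|K|%:R + 1).
have e0 : 0 < e by rewrite divr_gt0.
have Ke : (#|K|%:R * e)%:C%C < r.
  rewrite [ltRHS]rE ltcC /e mulrA ltr_pdivrMr// mulrC ltr_pM2l// ltrDl//.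
have [a' [b' [aa' bb' [x [y xy]]]]] :=
  generating_pair_dense (c 0 0 : L) (c 0 1 : L) e0.
pose c' : 'rV[B]_2 := \row_j (if j == 0 then (a' : B) else (b' : B)).
have c0 : c' 0 0 = a' by rewrite mxE.
have c1 : c' 0 1 = b' by rewrite mxE.
have small (u v : L) : (forall g z, cabs z <= 1 ->
    cabs (ev (coef v g - coef u g) z) <= e) -> ball (u : B) r (v : B).
  move=> uv; rewrite -ball_normE /=; apply: le_lt_trans Ke.
  apply: (@l1_norm_le (u - v)) => g z z1.
  by rewrite coefD coefN evB// cabsC -evB//; exact: uv.
exists c'; split.
  apply: rO; split=> // i j; rewrite (ord1 i).
  have [->|->] : j = 0 \/ j = 1.
    by case: j => -[|[|//]] j2; [left|right]; exact: val_inj.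
    rewrite c0; exact: small.
  rewrite c1; exact: small.
move=> u; pose w : 'rV[B]_2 :=
  \row_j (if j == 0 then ((u : L) * x : L) : B else ((u : L) * y : L)).
exists w; rewrite big_ord_recl big_ord1.
have -> : lift ord0 ord0 = 1 :> 'I_2 by exact: val_inj.
rewrite c1 c0 !mxE /=.
transitivity ((u : L) * (x * a' + y * b')); first by rewrite xy mulr1.
by rewrite mulrDr !mulrA.
Qed.

End StableRank.

Theorem theorem4p6 (R : realType) (K : finGroupType)
    (alpha : banach_action (disk_algebra R) K) :
  ltsr (l1_alg alpha) = 2%:E.
Proof.
have p2 : ltsr_pred (l1_alg alpha) 2 by apply/asboolP; split => //; exact: dense_Lg2.
rewrite /ltsr; case: pselect => [ex|[]]; last by exists 2%N.
case: ex_minnP => n pn minn; have := minn _ p2.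
case: n pn {minn} => [|[|[|n]]] // pn _.
- by have /asboolP[] := pn.
- by have /asboolP[_ /(@not_dense_Lg1 R K alpha)] := pn.
Qed.
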